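(* Suppose $G$ satisfies Assumption 3.1 (stated in the context) and $\mathbb{E}_G\varepsilon_1^3<\infty$. Then for all $h\ge0$, $$\tau_n\xrightarrow{d}\mathrm{N}(0,1)\quad\text{under }\mathbb{P}_{1-h/n^2},$$ which yields $\lim_{n\to\infty}\mathbb{P}_{1-h/n^2}(\text{reject }H_0)=\alpha$, where $H_0$ is rejected by the Dickey–Fuller test of asymptotic level $\alpha\in(0,1)$ based on $\tau_n$.
   Context: Notation: $\mathbb{N}=\{1,2,\ldots\}$, $\mathbb{Z}_+=\mathbb{N}\cup\{0\}$. $G$ is a (known) probability distribution on $\mathbb{Z}_+$ with probability mass function $g$, mean $\mu_G$ and variance $\sigma_G^2$. For $\theta\in[0,1]$, under $\mathbb{P}_\theta=\mathbb{P}_{\theta,G}$ the INAR(1) process $(X_t)_{t\ge0}$ is defined by $X_0=0$ and $X_t=\vartheta\circ X_{t-1}+\varepsilon_t$ for $t\in\mathbb{N}$, where $\vartheta\circ X_{t-1}=\sum_{j=1}^{X_{t-1}}Z^{(t)}_j$ (an empty sum is $0$), $(Z^{(t)}_j)_{j,t\in\mathbb{N}}$ are i.i.d. Bernoulli variables with success probability $\theta$, and, independently of these, $(\varepsilon_t)_{t\in\mathbb{N}}$ are i.i.d. with distribution $G$. For fixed $h$ one considers $n$ large enough that $1-h/n^2\in[0,1]$. The hypothesis $H_0:\theta=1$ is tested against $H_1:\theta<1$. The (standard) Dickey–Fuller statistic is $$\tau_n=\frac{\hat\theta_n^{\mathrm{OLS}}-1}{\sqrt{\sigma_G^2\bigl(\sum_{t=1}^nX_{t-1}^2\bigr)^{-1}}},\qquad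 \hat\theta_n^{\mathrm{OLS}}=\frac{\sum_{t=1}^nX_{t-1}(X_t-\mu_G)}{\sum_{t=1}^nX_{t-1}^2}$$ (its value when $\sum_{t=1}^n X_{t-1}^2=0$ is immaterial). The test rejects $H_0$ when $\tau_n<\Phi^{-1}(\alpha)$, with $\Phi$ the standard normal distribution function. Assumption 3.1 on $G$: one of the following holds: (1) the support of $G$ is $\{0,\ldots,M\}$ for some $M\in\mathbb{N}$; (2) the support of $G$ is $\mathbb{Z}_+$, $\sigma_G^2<\infty$, and $g$ is eventually decreasing, i.e. there is $M\in\mathbb{N}$ with $g(k+1)\le g(k)$ for all $k\ge M$. *)

(* Defs.v *)
From HB Require Import structures.
From mathcomp Require Import all_boot all_order all_algebra finmap.
From mathcomp Require Import all_classical all_reals all_analysis measurable_realfun.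
Set Implicit Arguments.
Unset Strict Implicit.
Unset Printing Implicit Defensive.
Import Order.TTheory GRing.Theory Num.Theory numFieldNormedType.Exports.
Local Open Scope classical_set_scope.
Local Open Scope ring_scope.

(* Mutual independence of a family of classes of events.  For sigma-algebras
   sigma(X i) this is mutual independence of the variables X i; formulating it
   on classes of events allows variables with values in different types. *)
Definition mutually_independent d (Omega : measurableType d) (R : realType)
    (P : probability Omega R) (I : choiceType) (F : I -> set_system Omega) :=
  forall (J : {fset I}) (A : I -> set Omega),
    (forall i, i \in J -> F i (A i)) ->
    P (\bigcap_(i in [set` J]) A i) = (\prod_(i <- J) P (A i))%E.

(* Weak convergence, through the distribution functions.  R and measurableTypeR R
   carry the same Borel sets under different displays: distributions of random
   variables live on the former, normal_prob on the latter. *)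
Definition cvg_in_distribution (R : realType) (mu : nat -> probability R R)
    (nu : probability (measurableTypeR R) R) :=
  forall x : R, {for x, continuous (fun y : R => nu `]-oo, y]%classic)} ->
    mu n `]-oo, x]%classic @[n --> \oo] --> nu `]-oo, x]%classic.

Definition Phi (R : realType) (x : R) : R := fine (normal_prob 0 1 `]-oo, x]%classic).

(* Meaningful on ]0, 1[, the range of Phi. *)
Definition Phi_inv (R : realType) : R -> R := pinv [set: R] (@Phi R).

Section innovation_distribution.
Context (R : realType) (G : probability nat R).

Definition pmf_of (k : nat) : R := fine (G [set k]).

Definition support_of : set nat := [set k | 0 < pmf_of k].

Definition mean_of : R := fine 'E_G[fun k => k%:R].

Definition variance_of : R := fine ('V_G[fun k => k%:R])%E.

Definition innovation_assumption :=
  (exists M, (1 <= M)%N /\ support_of = [set k | (k <= M)%N]) \/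
  [/\ support_of = [set: nat],
      ('V_G[fun k => k%:R] < +oo)%E &
      exists M, (1 <= M)%N /\
        forall k, (M <= k)%N -> pmf_of k.+1 <= pmf_of k].

(* The statistic as a function of the observed path x_0, x_1, ...; it is 0 when
   x_0 = ... = x_(n-1) = 0, since 0^-1 = 0. *)
Definition theta_ols (n : nat) (x : nat -> nat) : R :=
  (\sum_(1 <= t < n.+1) (x t.-1)%:R * ((x t)%:R - mean_of)) /
  (\sum_(1 <= t < n.+1) (x t.-1)%:R ^+ 2).

Definition dickey_fuller (n : nat) (x : nat -> nat) : R :=
  (theta_ols n x - 1) /
  Num.sqrt (variance_of * (\sum_(1 <= t < n.+1) (x t.-1)%:R ^+ 2)^-1).

End innovation_distribution.

Section inar1.
Context d (Omega : measurableType d).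
Context (Z : nat -> nat -> {mfun Omega >-> bool}).
Context (eps : nat -> {mfun Omega >-> nat}).

(* Times and summands are numbered from 0 in the driving variables: Z t j is
   the (j+1)-st thinning variable of step t+1 and eps t the innovation of step
   t+1. *)
Fixpoint inar1 (t : nat) (w : Omega) : nat :=
  if t is s.+1 then (\sum_(j < inar1 s w) Z s j w + eps s w)%N else 0%N.

Lemma measurable_nat_fun d' (T' : measurableType d') (f : nat -> T') :
  measurable_fun setT f.
Proof. by []. Qed.

Lemma measurable_inar1 t : measurable_fun setT (inar1 t).
Proof.
elim: t => [|t IH] /=; first exact: measurable_cst.
apply: measurable_fun_addn => //.
have mS k : measurable_fun setT (fun w => \sum_(j < k) Z t j w)%N.
  elim: k => [|k IHk].
    by under eq_fun do rewrite big_ord0; exact: measurable_cst.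
  under eq_fun do rewrite big_ord_recr/=.
  apply: measurable_fun_addn => //.
  by apply: (@measurableT_comp _ _ _ _ _ _ nat_of_bool).
move=> _ Y _; rewrite setTI.
rewrite [X in measurable X](_ : _ = \bigcup_k (inar1 t @^-1` [set k] `&`
    (fun w => \sum_(j < k) Z t j w)%N @^-1` Y)); last first.
  apply/seteqP; split=> [w /= Yw|w [k _ [/= -> //]]].
  by exists (inar1 t w).
apply: bigcupT_measurable => k; apply: measurableI.
  by rewrite -[X in measurable X]setTI; exact: IH.
by rewrite -[X in measurable X]setTI; exact: mS.
Qed.

Context (R : realType) (G : probability nat R).

Definition tau (n : nat) (w : Omega) : R := dickey_fuller G n (inar1^~ w).

Lemma measurable_tau n : measurable_fun setT (tau n).
Proof.
have mnat (f : nat -> R) t : measurable_fun setT (fun w => f (inar1 t w)).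
  exact: measurableT_comp (measurable_nat_fun f) (measurable_inar1 t).
have mD : measurable_fun setT
    (fun w => \sum_(1 <= t < n.+1) (inar1 t.-1 w ^ 2))%N.
  elim: (index_iota 1 n.+1) => [|t s IHs].
    by under eq_fun do rewrite big_nil; exact: measurable_cst.
  under eq_fun do rewrite big_cons.
  apply: measurable_fun_addn => //.
  exact: measurableT_comp (measurable_nat_fun (fun k => k ^ 2)%N)
    (measurable_inar1 t.-1).
have mfD (f : nat -> R) := measurableT_comp (measurable_nat_fun f) mD.
pose D w := (\sum_(1 <= t < n.+1) (inar1 t.-1 w ^ 2))%N.
have DE w : \sum_(1 <= t < n.+1) (inar1 t.-1 w)%:R ^+ 2 = (D w)%:R :> R.
  by rewrite /D natr_sum; apply: eq_bigr => t _; rewrite natrX.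
rewrite /tau /dickey_fuller /theta_ols.
under eq_fun do rewrite !DE.
apply: measurable_funM; last first.
  exact: (mfD (fun k => (Num.sqrt (variance_of G * k%:R^-1))^-1)).
apply: measurable_funB; last exact: measurable_cst.
apply: measurable_funM; last exact: (mfD (fun k => k%:R^-1)).
apply: measurable_sum => t; apply: measurable_funM.
  exact: (mnat (fun k => k%:R)).
exact: (mnat (fun k => k%:R - mean_of G)).
Qed.

HB.instance Definition _ n :=
  isMeasurableFun.Build _ _ Omega R (tau n) (measurable_tau n).

Definition driving_sigma_algebra (i : nat * nat + nat) : set_system Omega :=
  match i with
  | inl (t, j) => preimage_set_system [set: Omega] (Z t j) measurable
  | inr t => preimage_set_system [set: Omega] (eps t) measurable
  end.

(* Joint independence of all the driving variables: the Z t j are independent,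
   the eps t are independent, and the two families are independent. *)
Record inar1_law (theta : R) (P : probability Omega R) : Prop := {
  thinning_law : forall t j, distribution P (Z t j) =1 bernoulli_prob theta ;
  innovation_law : forall t, distribution P (eps t) =1 G ;
  driving_independent : mutually_independent P driving_sigma_algebra }.

End inar1.

(* Main.v *)
Require Import Defs.
From HB Require Import structures.
From mathcomp Require Import all_boot all_order all_algebra finmap.
From mathcomp Require Import all_classical all_reals all_analysis.
From mathcomp Require Import ring lra measurable_realfun.
Set Implicit Arguments.
Unset Strict Implicit.
Unset Printing Implicit Defensive.
Import Order.TTheory GRing.Theory Num.Theory numFieldNormedType.Exports.
Local Open Scope classical_set_scope.
Local Open Scope ring_scope.

(** Under theta = 1 the process is a random walk with drift: X_s is close to mu s,
    and the statistic is close to the sum of the standardized innovations with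
    weights s / (sum of the s^2)^(1/2), s < n.  The weights form a unit vector
    and each of them is at most of order n^(-1/2), so the sum is asymptotically
    Gaussian.  Under theta = 1 - h/n^2 the picture is unchanged: at step s about
    (1 - theta) X_s individuals are lost, hence O(1) individuals in total over n
    steps, which is negligible against a population of order n.

    Comparison with the weighted sum.  Write X_s = M_s + mu s - D_s with M the
    sum of the centred innovations xi and D the number of departures so far
    ([populationE]).
    In the numerator, the sums of M_s xi_s, D_s xi_s and X_s times departures
    are O(n) in expectation, against a main term of order n^(3/2).  In the
    denominator, the Euclidean norm of the path differs from mu times that of
    0, 1, ..., n - 1 by O(n) in expectation.  The random denominator is removed
    by writing tau <= x as an inequality between the numerator and x times the
    denominator ([pivot_lt_tau]); the resulting [pivot] differs from the
    weighted sum by O(n^(-1/2)) in L^1 ([expect_pivot_error]).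

    Central limit theorem.  Let heat v y be the probability that a centred
    Gaussian of variance v is at most y.  It solves the heat equation, so that
    trading Gaussian variance a^2 for an independent centred increment a u with
    u of variance 1 changes its expectation by O(|a|^3) only, by Taylor
    expansion ([heat_step]).  Trading the summands one after the other turns
    Phi (z / (1 + dl^2)^(1/2)) into the expectation of Phi ((z - V) / dl), V the
    weighted sum ([gaussian_smoothing_bound]).  The third moment makes the total
    error O(n^(-1/2)) for fixed dl.  Smoothing at the small scale dl is undone
    by monotonicity and the tails of Phi ([probability_le_smoothed],
    [probability_ge_smoothed]), and [event_probability_cvg] lets n tend to
    infinity before dl tends to 0.

    Independence enters through the sigma-algebra of the history before step t
    ([past_independent], [expect_past_eps], [expect_departures]). *)

(** * Taylor estimates from the mean value theorem *)

Section taylor.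
Context {R : realType}.
Implicit Types (f g : R -> R).

Lemma is_derive_continuous f (df x : R) : is_derive x 1 f df -> {for x, continuous f}.
Proof.
by move=> fx; apply/differentiable_continuous/derivable1_diffP.
Qed.

(** The rules of differentiation for explicit lambda-abstractions: in this form
    the derivative of a compound expression is read off a proof term. *)
Lemma is_deriveD_fun f g (x a b : R) : is_derive x 1 f a -> is_derive x 1 g b ->
  is_derive x 1 (fun s => f s + g s) (a + b).
Proof. exact: is_deriveD. Qed.

Lemma is_deriveB_fun f g (x a b : R) : is_derive x 1 f a -> is_derive x 1 g b ->
  is_derive x 1 (fun s => f s - g s) (a - b).
Proof. exact: is_deriveB. Qed.

Lemma is_deriveM_fun f g (x a b : R) : is_derive x 1 f a -> is_derive x 1 g b ->
  is_derive x 1 (fun s => f s * g s) (f x * b + g x * a).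
Proof. exact: is_deriveM. Qed.

Lemma is_derive_comp_fun f g (x a b : R) :
  is_derive (g x) 1 f a -> is_derive x 1 g b ->
  is_derive x 1 (fun s => f (g s)) (a * b).
Proof. exact: is_derive1_comp. Qed.

Lemma is_derive_id_fun (x : R) : is_derive x 1 (fun s : R => s) 1.
Proof. exact: is_derive_id. Qed.

Lemma is_derive_cst_fun (c x : R) : is_derive x 1 (fun=> c) 0.
Proof. exact: is_derive_cst. Qed.

(** One integration step: a derivative of size |s|^k forces growth of size
    |t|^(k+1).  The conditions on s say that it lies between 0 and t, so the
    lemma also serves for functions that are controlled on one side only. *)
Lemma growth_from_derivative g (g' : R -> R) (K t : R) (k : nat) : 0 <= K ->
  (forall s, `|s| <= `|t| -> 0 <= s * t -> is_derive s 1 g (g' s)) ->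
  g 0 = 0 ->
  (forall s, `|s| <= `|t| -> 0 <= s * t -> `|g' s| <= K * `|s| ^+ k) ->
  `|g t| <= K * `|t| ^+ k.+1.
Proof.
move=> K0 dg g0 bg.
have cont (a b : R) : (forall s, a <= s <= b -> is_derive s 1 g (g' s)) ->
  {within `[a, b], continuous g}.
  move=> H; apply: derivable_within_continuous => s.
  by rewrite in_itv/= => /H.
have main c : `|c| <= `|t| -> 0 <= c * t -> g t = g' c * t ->
    `|g t| <= K * `|t| ^+ k.+1.
  move=> ct c0 ->; have := bg c ct c0; rewrite normrM exprSr mulrA => h.
  apply: ler_wpM2r => //; apply: le_trans h _.
  by apply: ler_wpM2l => //; apply: lerXn2r.
case: (ltgtP t 0) => t0.
- have [||c] := @MVT _ g g' t 0 t0.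
  + move=> x; rewrite in_itv/= => /andP[x1 x2]; apply: dg; last nra.
    by rewrite !ltr0_norm// lerN2 ltW.
  + apply: cont => x /andP[x1 x2]; apply: dg; last nra.
    by rewrite !ler0_norm// ?lerN2// ltW.
  rewrite in_itv/= g0 => /andP[c1 c2]; rewrite !sub0r mulrN => /oppr_inj.
  by apply: main; [rewrite !ltr0_norm// lerN2 ltW|nra].
- have [||c] := @MVT _ g g' 0 t t0.
  + move=> x; rewrite in_itv/= => /andP[x1 x2]; apply: dg; last nra.
    by rewrite !gtr0_norm// ltW.
  + apply: cont => x /andP[x1 x2]; apply: dg; last nra.
    by rewrite !ger0_norm// ltW.
  rewrite in_itv/= g0 => /andP[c1 c2]; rewrite !subr0.
  by apply: main; [rewrite !gtr0_norm// ltW|nra].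
- by rewrite t0 g0 normr0 exprS mul0r mulr0.
Qed.

Lemma is_derive_shift f (df y s : R) :
  is_derive (y + s) 1 f df -> is_derive s 1 (fun s => f (y + s)) df.
Proof.
move=> fd; have sd : is_derive s (1:R) (fun s => y + s) (1:R).
  rewrite -[X in is_derive _ _ _ X]add0r.
  exact: is_deriveD_fun.
by rewrite -[df]mulr1; apply: is_derive_comp_fun.
Qed.

(** The remainder, its derivative and its second derivative vanish at 0, and the
    third derivative is bounded: three integration steps. *)
Lemma taylor2 f (f1 f2 f3 : R -> R) (K y t : R) : 0 <= K ->
  (forall x : R, is_derive x 1 f (f1 x)) ->
  (forall x : R, is_derive x 1 f1 (f2 x)) ->
  (forall x : R, is_derive x 1 f2 (f3 x)) -> (forall x, `|f3 x| <= K) ->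
  `|f (y + t) - f y - t * f1 y - t ^+ 2 / 2 * f2 y| <= K * `|t| ^+ 3.
Proof.
move=> K0 d1 d2 d3 b3.
pose g0 t := f (y + t) - f y - t * f1 y - t ^+ 2 / 2 * f2 y.
pose g1 t := f1 (y + t) - f1 y - t * f2 y.
pose g2 t := f2 (y + t) - f2 y.
have D2 (s : R) : is_derive s 1 g2 (f3 (y + s)).
  have h := is_derive_shift (d3 (y + s)).
  rewrite -[X in is_derive _ _ _ X]subr0.
  exact: is_deriveB_fun.
have D1 (s : R) : is_derive s 1 g1 (g2 s).
  have := is_deriveB_fun (is_deriveB_fun (is_derive_shift (d2 (y + s)))
    (is_derive_cst_fun (f1 y) s))
    (is_deriveM_fun (is_derive_id_fun s) (is_derive_cst_fun (f2 y) s)).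
  by move/is_derive_eq; apply; rewrite /g2; ring.
have D0 (s : R) : is_derive s 1 g0 (g1 s).
  have := is_deriveB_fun (is_deriveB_fun (is_deriveB_fun
    (is_derive_shift (d1 (y + s))) (is_derive_cst_fun (f y) s))
    (is_deriveM_fun (is_derive_id_fun s) (is_derive_cst_fun (f1 y) s)))
    (is_deriveM_fun (is_deriveM_fun (is_deriveM_fun (is_derive_id_fun s)
      (is_derive_id_fun s)) (is_derive_cst_fun 2^-1 s))
      (is_derive_cst_fun (f2 y) s)).
  by move/is_derive_eq; apply; rewrite /g1; field.
apply: (growth_from_derivative (g := g0) (g' := g1)) => //.
  by rewrite /g0 addr0; ring.
move=> s _ _; apply: (growth_from_derivative (g := g1) (g' := g2)) => //.
  by rewrite /g1 addr0; ring.
move=> {}s _ _; apply: (growth_from_derivative (g := g2) (g' := fun s => f3 (y + s))) => //.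
  by rewrite /g2 addr0; ring.
by move=> {}s _ _; rewrite expr0 mulr1.
Qed.

(** One-sided because it is applied in the variance of a Gaussian, which has to
    stay away from 0. *)
Lemma taylor1_right f (f1 f2 : R -> R) (K v t : R) : 0 <= K -> 0 <= t ->
  (forall x : R, v <= x -> is_derive x 1 f (f1 x)) ->
  (forall x : R, v <= x -> is_derive x 1 f1 (f2 x)) ->
  (forall x, v <= x -> `|f2 x| <= K) ->
  `|f (v + t) - f v - t * f1 v| <= K * t ^+ 2.
Proof.
move=> K0; rewrite le_eqVlt => /predU1P[<- _ _ _|t0 d1 d2 b2].
  by rewrite addr0 subrr mul0r subr0 normr0 expr0n mulr0.
pose g1 t := f (v + t) - f v - t * f1 v.
pose g2 t := f1 (v + t) - f1 v.
have D2 (s : R) : 0 <= s -> is_derive s 1 g2 (f2 (v + s)).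
  move=> s0; have h := is_derive_shift (d2 (v + s) ltac:(by rewrite lerDl)).
  rewrite -[X in is_derive _ _ _ X]subr0.
  exact: is_deriveB_fun.
have D1 (s : R) : 0 <= s -> is_derive s 1 g1 (g2 s).
  move=> s0; have h := is_derive_shift (d1 (v + s) ltac:(by rewrite lerDl)).
  have := is_deriveB_fun (is_deriveB_fun h (is_derive_cst_fun (f v) s))
    (is_deriveM_fun (is_derive_id_fun s) (is_derive_cst_fun (f1 v) s)).
  by move/is_derive_eq; apply; rewrite /g2; ring.
rewrite -[t in leRHS]gtr0_norm//.
apply: (growth_from_derivative (g := g1) (g' := g2)) => //.
- by move=> s _; rewrite pmulr_lge0//; exact: D1.
- by rewrite /g1 addr0; ring.
move=> s _; rewrite pmulr_lge0// => s0.
have rge0 r : `|r| <= `|s| -> 0 <= r * s -> 0 <= r.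
  move: s0; rewrite le_eqVlt => /predU1P[<-|s0 _]; last by rewrite pmulr_lge0.
  by rewrite normr0 normr_le0 => /eqP ->.
apply: (growth_from_derivative (g := g2) (g' := fun s => f2 (v + s))) => //.
- by move=> r rs rs0; apply: D2; exact: rge0 rs rs0.
- by rewrite /g2 addr0; ring.
by move=> r rs rs0; rewrite expr0 mulr1; apply: b2; rewrite lerDl; exact: rge0 rs rs0.
Qed.

End taylor.

(** * The Gaussian density and distribution function *)

Section gaussian.
Context {R : realType}.
Notation phi := (@normal_pdf R 0 1).

Lemma phiE (x : R) : phi x = normal_peak 1 * expR (- (x ^+ 2 / 2)).
Proof.
by rewrite normal_pdfE ?oner_eq0// /normal_fun subr0 expr1n mulNr.
Qed.

Lemma phi_ge0 (x : R) : 0 <= phi x. Proof. exact: normal_pdf_ge0. Qed.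

Lemma normal_peak1_le1 : normal_peak 1 <= 1 :> R.
Proof.
rewrite /normal_peak invf_le1 ?sqrtr_gt0; last first.
  by rewrite expr1n mul1r mulrn_wgt0// pi_gt0.
rewrite -[leLHS]sqrtr1 ler_sqrt; last by rewrite expr1n mul1r mulrn_wge0// pi_ge0.
by rewrite expr1n mul1r mulr2n; have := pi_ge2 R; lra.
Qed.

Lemma is_derive_phi (x : R) : is_derive x 1 phi (- x * phi x).
Proof.
rewrite (_ : normal_pdf 0 1 = fun x : R => normal_peak 1 * expR (- (x * x * 2^-1))); last first.
  by apply/funext => y; rewrite phiE expr2.
have h := is_deriveM_fun (is_deriveM_fun (is_derive_id_fun x)
      (is_derive_id_fun x)) (is_derive_cst_fun 2^-1 x).
have := is_deriveM_fun (is_derive_cst_fun (normal_peak (1:R)) x)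
  (is_derive_comp_fun (is_derive_expR _) (is_deriveB_fun (is_derive_cst_fun 0 x) h)).
rewrite (_ : (fun s => _ * expR _) =
  (fun s : R => normal_peak 1 * expR (- (s * s * 2^-1)))); last first.
  by apply/funext => y; rewrite sub0r.
by move/is_derive_eq; apply; rewrite !sub0r; field.
Qed.

Lemma Phi_EFin (x : R) : (Phi x)%:E = normal_prob 0 1 `]-oo, x]%classic.
Proof. by rewrite /Phi fineK// fin_num_measure. Qed.

Lemma is_derive_Phi (x : R) : is_derive x 1 (@Phi R) (phi x).
Proof.
have [||||h1 h2] := @continuous_FTC1 R phi -oo%O x (x + 1).
- by rewrite ltrDl.
- by apply: integrableS (integrable_normal_pdf 0 1).
- exact: ltNyr.
- by apply: continuous_normal_pdf; rewrite oner_eq0.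
have d1 : derivable (@Phi R) x 1 := h1.
have d2 : derive1 (@Phi R) x = phi x := h2.
by rewrite -d2 derive1E; exact: derivableP.
Qed.

Lemma Phi_ge0 (x : R) : 0 <= Phi x. Proof. exact: fine_ge0. Qed.

Lemma Phi_le1 (x : R) : Phi x <= 1.
Proof. by rewrite -lee_fin Phi_EFin; exact: probability_le1. Qed.

Lemma Phi_homo : {homo @Phi R : x y / x <= y}.
Proof.
move=> x y xy; rewrite -lee_fin !Phi_EFin le_measure// ?inE//.
by apply: subset_itvl; rewrite bnd_simp.
Qed.

Lemma continuous_Phi : continuous (@Phi R).
Proof. by move=> x; exact: is_derive_continuous (is_derive_Phi x). Qed.

Lemma expRN_mul_le1 (u : R) : 0 <= u -> u * expR (- u) <= 1.
Proof.
move=> u0; rewrite expRN ler_pdivrMr ?expR_gt0// mul1r.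
by apply: le_trans (expR_ge1Dx u); rewrite lerDr.
Qed.

Lemma phi_le1 x : phi x <= 1.
Proof. by apply: le_trans normal_peak1_le1; apply: normal_pdf_ub; rewrite oner_eq0. Qed.

(** u exp(-u) <= 1 at u = x^2/2. *)
Lemma phi_sqr_bound (x : R) : x ^+ 2 * phi x <= 2.
Proof.
have := @expRN_mul_le1 (x ^+ 2 / 2) ltac:(by rewrite divr_ge0// sqr_ge0).
have := normal_peak1_le1; have := @normal_peak_ge0 R 1.
rewrite phiE; move: (expR _) (normal_peak _) (sqr_ge0 x) => e p; nra.
Qed.

(** Half of the exponent is spent on each factor x^2: u exp(-u) <= 1 at
    u = x^2/4, squared. *)
Lemma phi_quartic_bound (x : R) : x ^+ 4 * phi x <= 16.
Proof.
have := @expRN_mul_le1 (x ^+ 2 / 4) ltac:(by rewrite divr_ge0// sqr_ge0).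
have := normal_peak1_le1; have := @normal_peak_ge0 R 1.
rewrite phiE (_ : - (x ^+ 2 / 2) = - (x ^+ 2 / 4) - x ^+ 2 / 4); last by field.
rewrite expRD; have := expR_ge0 (- (x ^+ 2 / 4)).
move: (expR _) (normal_peak _) (sqr_ge0 x) => e p x0 e0 p0 p1 h.
have : x ^+ 2 / 4 * e * (x ^+ 2 / 4 * e) <= 1.
  by apply: mulr_ile1 => //; apply: mulr_ge0 => //; apply: divr_ge0.
have : 0 <= x ^+ 2 / 4 * e * (x ^+ 2 / 4 * e) by rewrite mulr_ge0// mulr_ge0// divr_ge0.
rewrite (_ : x ^+ 4 * (p * (e * e)) =
  16 * (p * (x ^+ 2 / 4 * e * (x ^+ 2 / 4 * e)))); last by field.
by move: (_ * _ * (_ * _)) => q q0 q1; nra.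
Qed.

End gaussian.

(** * The heat kernel smoothing of a half-line *)

Section heat.
Context {R : realType}.
Notation phi := (@normal_pdf R 0 1).
Implicit Types v y : R.

Definition isqrt v : R := (Num.sqrt v)^-1.

(** The probability that a centred Gaussian of variance v is at most y.  It is
    a smooth substitute for the indicator of y >= 0, and it is carried by the
    heat flow: adding an independent Gaussian of variance a^2 amounts to
    replacing v by v + a^2. *)
Definition heat v y : R := Phi (y * isqrt v).
Definition heat_x v y : R := isqrt v * phi (y * isqrt v).
Definition heat_xx v y : R := - isqrt v ^+ 2 * (y * isqrt v * phi (y * isqrt v)).

Lemma isqrt_ge0 v : 0 <= isqrt v.
Proof. by rewrite invr_ge0 sqrtr_ge0. Qed.

Lemma isqrt_le dl v : 0 < dl -> dl ^+ 2 <= v -> isqrt v <= dl^-1.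
Proof.
move=> dl0 dlv.
have v0 : 0 < v by apply: lt_le_trans dlv; rewrite exprn_gt0.
rewrite lef_pV2 ?posrE ?sqrtr_gt0//.
by rewrite -(ger0_norm (ltW dl0)) -sqrtr_sqr ler_sqrt// ltW.
Qed.

Lemma is_derive_isqrt v : 0 < v -> is_derive v 1 isqrt (- isqrt v ^+ 3 / 2).
Proof.
move=> v0; have sv0 : Num.sqrt v != 0 by rewrite gt_eqF// sqrtr_gt0.
have := is_deriveV sv0 (is_derive1_sqrt v0).
move/is_derive_eq; apply; rewrite /isqrt /GRing.scale/=.
by field; rewrite gt_eqF// sqrtr_gt0.
Qed.

Lemma is_derive_scale c y : is_derive y 1 (fun x => x * c) c.
Proof.
have := is_deriveM_fun (is_derive_id_fun y) (is_derive_cst_fun c y).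
by move/is_derive_eq; apply; rewrite mulr0 add0r mulr1.
Qed.

Lemma is_derive_heat_x v y : is_derive y 1 (heat v) (heat_x v y).
Proof.
have := is_derive_comp_fun (is_derive_Phi _) (is_derive_scale (isqrt v) y).
by move/is_derive_eq; apply; rewrite mulrC.
Qed.

Lemma is_derive_heat_xx v y : is_derive y 1 (heat_x v) (heat_xx v y).
Proof.
have := is_deriveM_fun (is_derive_cst_fun (isqrt v) y)
  (is_derive_comp_fun (is_derive_phi _) (is_derive_scale (isqrt v) y)).
by move/is_derive_eq; apply; rewrite /heat_xx; ring.
Qed.

Lemma is_derive_id_phi (w : R) :
  is_derive w 1 (fun w : R => w * phi w) ((1 - w ^+ 2) * phi w).
Proof.
have := is_deriveM_fun (is_derive_id_fun w) (is_derive_phi w).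
by move/is_derive_eq; apply; ring.
Qed.

Lemma is_derive_heat_xxx v y : is_derive y 1 (heat_xx v)
  (isqrt v ^+ 3 * ((y * isqrt v) ^+ 2 - 1) * phi (y * isqrt v)).
Proof.
have := is_deriveM_fun (is_derive_cst_fun (- isqrt v ^+ 2) y)
  (is_derive_comp_fun (is_derive_id_phi _) (is_derive_scale (isqrt v) y)).
by move/is_derive_eq; apply; ring.
Qed.

Lemma is_derive_mul_isqrt v y : 0 < v ->
  is_derive v 1 (fun v => y * isqrt v) (- isqrt v ^+ 3 / 2 * y).
Proof.
move=> v0; have := is_deriveM_fun (is_derive_cst_fun y v) (is_derive_isqrt v0).
by move/is_derive_eq; apply; ring.
Qed.

Lemma heat_equation v y : 0 < v ->
  is_derive v 1 (heat^~ y) (2^-1 * heat_xx v y).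
Proof.
move=> v0.
have := is_derive_comp_fun (is_derive_Phi _) (is_derive_mul_isqrt y v0).
by move/is_derive_eq; apply; rewrite /heat_xx; ring.
Qed.

Lemma is_derive_heat_tt v y : 0 < v ->
  is_derive v 1 (fun v => 2^-1 * heat_xx v y)
    (isqrt v ^+ 4 * (3 / 4 * (y * isqrt v) - (y * isqrt v) ^+ 3 / 4) *
     phi (y * isqrt v)).
Proof.
move=> v0.
have dr2 := is_deriveM_fun (is_derive_isqrt v0) (is_derive_isqrt v0).
have := is_deriveM_fun (is_derive_cst_fun (- 2^-1) v) (is_deriveM_fun dr2
  (is_derive_comp_fun (is_derive_id_phi _) (is_derive_mul_isqrt y v0))).
rewrite (_ : (fun s => _ * _) = (fun v => 2^-1 * heat_xx v y)); last first.
  by apply/funext => s; rewrite /heat_xx; ring.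
by move/is_derive_eq; apply; field.
Qed.

Lemma heat_xxx_bound dl v y : 0 < dl -> dl ^+ 2 <= v ->
  `|isqrt v ^+ 3 * ((y * isqrt v) ^+ 2 - 1) * phi (y * isqrt v)| <= 3 * dl^-1 ^+ 3.
Proof.
move=> dl0 dlv; set w := y * _.
rewrite -mulrA normrM mulrC ler_pM//.
  have := phi_sqr_bound w; have := phi_le1 w; have := phi_ge0 w.
  have := sqr_ge0 w; rewrite mulrBl mul1r ler_norml; move: (phi w) => p *.
  by apply/andP; split; nra.
rewrite normrX ger0_norm ?isqrt_ge0//; apply: lerXn2r; rewrite ?nnegrE ?isqrt_ge0//.
  by rewrite invr_ge0 ltW.
exact: isqrt_le.
Qed.

Lemma heat_tt_bound dl v y : 0 < dl -> dl ^+ 2 <= v ->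
  `|isqrt v ^+ 4 * (3 / 4 * (y * isqrt v) - (y * isqrt v) ^+ 3 / 4) *
     phi (y * isqrt v)| <= 6 * dl^-1 ^+ 4.
Proof.
move=> dl0 dlv; set w := y * _.
rewrite -mulrA normrM mulrC ler_pM//.
  have p0 := phi_ge0 w; have p1 := phi_le1 w.
  have h2 := phi_sqr_bound w; have h4 := phi_quartic_bound w.
  have wl : `|w * phi w| <= 3 / 2.
    have s1 := sqr_ge0 (w - 1); have s2 := sqr_ge0 (w + 1).
    rewrite ler_norml; move: p0 p1 h2 h4; move: (phi w) => p *.
    by apply/andP; split; nra.
  have wc : `|w ^+ 3 * phi w| <= 9.
    rewrite ler_norml; move: p0 p1 h2 h4; move: (phi w) => p p0 p1 h2 h4.
    have s1 := mulr_ge0 p0 (sqr_ge0 (w ^+ 2 - w)).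
    have s2 := mulr_ge0 p0 (sqr_ge0 (w ^+ 2 + w)).
    by apply/andP; split; nra.
  rewrite (_ : _ * phi w = 3 / 4 * (w * phi w) - (w ^+ 3 * phi w) / 4); last by ring.
  by move: wl wc; rewrite !ler_norml => /andP[? ?] /andP[? ?]; apply/andP; split; lra.
rewrite normrX ger0_norm ?isqrt_ge0//; apply: lerXn2r; rewrite ?nnegrE ?isqrt_ge0//.
  by rewrite invr_ge0 ltW.
exact: isqrt_le.
Qed.

Definition heat_cst (dl : R) : R := 3 * dl^-1 ^+ 3 + 6 * dl^-1 ^+ 4.

Lemma heat_cst_ge0 dl : 0 < dl -> 0 <= heat_cst dl.
Proof.
by move=> dl0; rewrite addr_ge0// mulr_ge0// exprn_ge0// invr_ge0 ltW.
Qed.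

(** The replacement estimate.  Moving the space variable by - a u and lowering
    the time by a^2 have the same effect up to order three, apart from the two
    displayed terms.  These have expectation 0 when u is centred, of variance
    1, and independent of y: the second order term in u is compensated by the
    first order term in time, because of the heat equation. *)
Lemma heat_step dl v a u y : 0 < dl -> dl ^+ 2 <= v ->
  `|heat v (y - a * u) - heat (v + a ^+ 2) y + a * u * heat_x v y
    - a ^+ 2 / 2 * (u ^+ 2 - 1) * heat_xx v y|
  <= heat_cst dl * (`|a * u| ^+ 3 + a ^+ 4).
Proof.
move=> dl0 dlv.
have v0 x : v <= x -> 0 < x.
  by move=> vx; apply: lt_le_trans vx; apply: lt_le_trans dlv; rewrite exprn_gt0.
have K30 : 0 <= 3 * dl^-1 ^+ 3 by rewrite mulr_ge0// exprn_ge0// invr_ge0 ltW.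
have K40 : 0 <= 6 * dl^-1 ^+ 4 by rewrite mulr_ge0// exprn_ge0// invr_ge0 ltW.
have := @taylor2 _ (heat v) (heat_x v) (heat_xx v)
  (fun y => isqrt v ^+ 3 * ((y * isqrt v) ^+ 2 - 1) * phi (y * isqrt v)) _ y (- (a * u)) K30
  (is_derive_heat_x v) (is_derive_heat_xx v) (is_derive_heat_xxx v)
  (fun y => @heat_xxx_bound dl v y dl0 dlv).
have := @taylor1_right _ (heat^~ y) (fun v => 2^-1 * heat_xx v y)
  (fun v => isqrt v ^+ 4 * (3 / 4 * (y * isqrt v) - (y * isqrt v) ^+ 3 / 4) *
     phi (y * isqrt v)) _ v (a ^+ 2) K40 (sqr_ge0 a)
  (fun x vx => heat_equation y (v0 x vx)) (fun x vx => is_derive_heat_tt y (v0 x vx))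
  (fun x vx => @heat_tt_bound dl x y dl0 (le_trans dlv vx)).
rewrite normrN -exprM => h1 h2.
have p3 : 0 <= `|a * u| ^+ 3 by rewrite exprn_ge0.
have p4 : 0 <= a ^+ 4 by rewrite exprn_even_ge0.
rewrite (_ : heat v (y - a * u) - heat (v + a ^+ 2) y + _ - _ =
   (heat v (y - a * u) - heat v y - - (a * u) * heat_x v y -
     (- (a * u)) ^+ 2 / 2 * heat_xx v y) -
   (heat (v + a ^+ 2) y - heat v y - a ^+ 2 * (2^-1 * heat_xx v y))); last first.
  move: (heat v _) (heat (v + _) _) (heat v y) (heat_x _ _) (heat_xx _ _) => *; ring.
apply: le_trans (ler_normB _ _) _; apply: le_trans (lerD h2 h1) _.
by rewrite /heat_cst mulrDr; nra.
Qed.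

Lemma heat_bounds v y : 0 <= heat v y <= 1.
Proof. by rewrite /heat Phi_ge0 Phi_le1. Qed.

Lemma heat_x_bound v y : `|heat_x v y| <= isqrt v.
Proof.
rewrite normrM !ger0_norm ?isqrt_ge0 ?phi_ge0//.
by rewrite ler_piMr ?isqrt_ge0 ?phi_le1.
Qed.

Lemma heat_xx_bound v y : `|heat_xx v y| <= isqrt v ^+ 2 * 2.
Proof.
have r0 : 0 <= isqrt v ^+ 2 := sqr_ge0 _.
rewrite /heat_xx normrM normrN (ger0_norm r0); apply: ler_wpM2l => //.
set w := y * _; have p0 := phi_ge0 w; have p1 := phi_le1 w.
have h2 := phi_sqr_bound w.
have s1 := mulr_ge0 p0 (sqr_ge0 (w - 1)); have s2 := mulr_ge0 p0 (sqr_ge0 (w + 1)).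
rewrite ler_norml; move: (phi w) p0 p1 h2 s1 s2 => p *.
by apply/andP; split; nra.
Qed.

Lemma heat_lipschitz v (x y : R) : `|heat v x - heat v y| <= isqrt v * `|x - y|.
Proof.
have := @growth_from_derivative _ (fun t => heat v (y + t) - heat v y)
  (fun t => heat_x v (y + t)) (isqrt v) (x - y) 0 (isqrt_ge0 v).
rewrite /= expr1 (_ : y + (x - y) = x); last by ring.
apply.
- move=> s _ _; rewrite -[X in is_derive _ _ _ X]subr0.
  by have := is_deriveB_fun (is_derive_shift (is_derive_heat_x v (y + s)))
    (is_derive_cst_fun (heat v y) s); rewrite !subr0.
- by rewrite addr0 subrr.
- by move=> s _ _; rewrite mulr1 heat_x_bound.
Qed.

End heat.

(** * Expectation of a product of independent variables *)

Section expectation.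
Context d (T : measurableType d) (R : realType) (P : probability T R).
Implicit Types X Y : T -> R.

Definition independent_pair X Y := forall A B, measurable A -> measurable B ->
  P (X @^-1` A `&` Y @^-1` B) = (P (X @^-1` A) * P (Y @^-1` B))%E.

(** The joint law of X and Y agrees with the product of their laws on
    rectangles, hence everywhere; Fubini's theorem then splits the integral of
    the product. *)
Lemma independent_product X Y :
  independent_pair X Y ->
  P.-integrable setT (EFin \o X) -> P.-integrable setT (EFin \o Y) ->
  P.-integrable setT (EFin \o (fun w => X w * Y w)) /\
  \int[P]_w (X w * Y w) = (\int[P]_w X w) * (\int[P]_w Y w).
Proof.
move=> XY iX iY.
have mX : measurable_fun setT X by case/integrableP : iX => /measurable_EFinP.
have mY : measurable_fun setT Y by case/integrableP : iY => /measurable_EFinP.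
pose X' : {mfun T >-> R} := mfun_Sub (mem_set mX).
pose Y' : {mfun T >-> R} := mfun_Sub (mem_set mY).
have mXY : measurable_fun setT (fun w => (X w, Y w)) by apply/measurable_fun_pair.
pose Z' : {mfun T >-> (R * R)%type} := mfun_Sub (mem_set mXY).
pose m1 := distribution P X'; pose m2 := distribution P Y'.
pose m := distribution P Z'.
have mE A : measurable A -> (m1 \x m2)%E A = m A.
  by apply: product_measure_unique => B C mB mC; exact: XY.
pose f (z : R * R) := (z.1 * z.2)%:E.
have mf : measurable_fun setT f.
  by apply/measurable_EFinP; apply: measurable_funM;
    [exact: measurable_fst|exact: measurable_snd].
have iX1 : m1.-integrable setT EFin by apply: integrable_pushforward.
have iY1 : m2.-integrable setT EFin by apply: integrable_pushforward.
have X1fin : (\int[m1]_x `|x%:E| \is a fin_num)%E.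
  by apply: integrable_fin_num => //; exact: integrable_abse.
have Y1fin : (\int[m2]_x `|x%:E| \is a fin_num)%E.
  by apply: integrable_fin_num => //; exact: integrable_abse.
have if12 : (m1 \x m2)%E.-integrable setT f.
  apply/integrable12ltyP => //.
  rewrite (_ : (\int[m1]_x _)%E = (\int[m1]_x (`|x%:E| * \int[m2]_y `|y%:E|))%E).
    rewrite ge0_integralZr//; [|by apply: measurableT_comp|exact: integral_ge0].
    apply: lte_mul_pinfty => //; first exact: integral_ge0.
    by rewrite -ge0_fin_numE// integral_ge0.
  apply: eq_integral => x _.
  rewrite -ge0_integralZl//; last by apply: measurableT_comp.
  by apply: eq_integral => y _; rewrite /f EFinM abseM.
have ifm : m.-integrable setT f.
  apply/integrableP; split => //.
  move/integrableP : if12 => [_].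
  by rewrite (eq_measure_integral m)// => A mA _; exact: mE.
have iXY : P.-integrable setT (f \o Z').
  apply/integrableP; split; first exact: measurableT_comp.
  move/integrableP : ifm => [_]; rewrite /m.
  by rewrite ge0_integral_distribution//; exact: measurableT_comp.
split; first exact: iXY.
rewrite /Rintegral -[X in fine X]/(\int[P]_w (f \o Z') w)%E.
rewrite -integral_distribution// -/m (eq_measure_integral (m1 \x m2)%E); last first.
  by move=> A mA _; apply/esym; exact: mE.
rewrite -integral12_prod_meas1//.
rewrite /fubini_F (_ : (\int[m1]_x _)%E = (\int[m1]_x (x%:E * \int[m2]_y y%:E))%E); last first.
  apply: eq_integral => x _; rewrite -integralZl//.
have Y2fin : (\int[m2]_x x%:E \is a fin_num)%E by exact: integrable_fin_num.
rewrite -(fineK Y2fin) integralZr//.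
rewrite (integral_distribution (X := X'))// (integral_distribution (X := Y'))//.
by rewrite fineM//; exact: integrable_fin_num.
Qed.

End expectation.

(** * The past of the process and its independence from the present *)

Section past.
Context d (Omega : measurableType d) (R : realType) (P : probability Omega R).
Context (Z : nat -> nat -> {mfun Omega >-> bool}).
Context (eps : nat -> {mfun Omega >-> nat}).

Notation index := (nat * nat + nat)%type.
Notation driving := (driving_sigma_algebra Z eps).

Definition driving_time (i : index) : nat :=
  match i with inl (t, _) => t | inr t => t end.

(** The events that constrain finitely many driving variables of steps before t.
    Unconstrained coordinates carry the full event, so that an intersection of
    two cylinders is taken coordinate by coordinate. *)
Definition past_cylinders (t : nat) : set_system Omega :=
  [set C | exists (J : {fset index}) (A : index -> set Omega),
    [/\ forall i, i \in J -> (driving_time i < t)%N,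
        forall i, driving i (A i),
        forall i, i \notin J -> A i = setT &
        C = \bigcap_i A i]].

(** The probability space seen through the history strictly before step t: a
    function on it is measurable when it is determined by that history. *)
Definition past t := g_sigma_algebraType (past_cylinders t).

Lemma driving_measurable i A : driving i A -> measurable A.
Proof.
by case: i => [[t j]|t] [B mB <-]; apply: measurable_funP.
Qed.

Lemma drivingT i : driving i setT.
Proof. by case: i => [[t j]|t]; exists setT => //; rewrite setTI preimage_setT. Qed.

Lemma drivingI i A B : driving i A -> driving i B -> driving i (A `&` B).
Proof.
by case: i => [[t j]|t] [C mC <-] [D mD <-]; exists (C `&` D);
  rewrite ?setTI ?preimage_setI//; exact: measurableI.
Qed.

Lemma past_cylindersT t : past_cylinders t setT.
Proof.
exists fset0, (fun=> setT); split => //; first by move=> i; exact: drivingT.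
by apply/seteqP.
Qed.

Lemma past_cylindersI t : setI_closed (past_cylinders t).
Proof.
move=> _ _ [J [A [Jt FA AT ->]]] [K [B [Kt FB BT ->]]].
exists (J `|` K)%fset, (fun i => A i `&` B i); split.
- by move=> i; rewrite in_fsetU => /orP[/Jt|/Kt].
- by move=> i; exact: drivingI.
- by move=> i; rewrite in_fsetU negb_or => /andP[/AT -> /BT ->]; rewrite setTI.
- by rewrite bigcapI.
Qed.

Lemma past_cylinders_sub i t A :
  (driving_time i < t)%N -> driving i A -> past_cylinders t A.
Proof.
move=> it FA; exists [fset i]%fset, (fun j => if j == i then A else setT); split.
- by move=> j; rewrite in_fset1 => /eqP ->.
- by move=> j; case: eqP => [->|_] //; exact: drivingT.
- by move=> j; rewrite in_fset1 => /negbTE ->.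
- apply/seteqP; split=> [w Aw j _|w /(_ i I)]; last by rewrite eqxx.
  by case: ifP.
Qed.

Lemma past_cylinders_measurable t C : past_cylinders t C -> measurable C.
Proof.
move=> [J [A [_ FA AT ->]]].
rewrite (_ : \bigcap_i A i = \bigcap_(i in [set` J]) A i).
  by apply: fin_bigcap_measurable => // i _; exact: driving_measurable (FA i).
apply/seteqP; split=> [w Aw i _|w Aw i _]; first exact: Aw.
by have [iJ|/AT ->//] := boolP (i \in J); exact: Aw.
Qed.

Hypothesis indep : mutually_independent P driving.

Lemma past_cylinders_independent t i C B : driving_time i = t -> driving i B ->
  past_cylinders t C -> P (C `&` B) = (P C * P B)%E.
Proof.
move=> it FB [J [A [Jt FA AT ->]]].
have iJ : i \notin J by apply/negP => /Jt; rewrite it ltnn.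
have capE (K : {fset index}) (A' : index -> set Omega) :
    (forall j, j \notin K -> A' j = setT) ->
    \bigcap_j A' j = \bigcap_(j in [set` K]) A' j.
  move=> A'T; apply/seteqP; split=> [w Aw j _|w Aw j _]; first exact: Aw.
  by have [jK|/A'T ->//] := boolP (j \in K); exact: Aw.
pose A' j := if j == i then B else A j.
have A'T j : j \notin (i |` J)%fset -> A' j = setT.
  by rewrite in_fset1U negb_or /A' => /andP[/negbTE -> /AT].
rewrite (_ : _ `&` B = \bigcap_j A' j); last first.
  apply/seteqP; split=> [w [Aw Bw] j _|w A'w]; first by rewrite /A'; case: ifP => // _; exact: Aw.
  split=> [j _|]; last by have := A'w i Logic.I; rewrite /A' eqxx.
  have := A'w j Logic.I; rewrite /A'; case: eqP => // -> _.
  by rewrite AT.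
rewrite (capE _ _ A'T) (capE _ _ AT) !indep//; last first.
  by move=> j _; rewrite /A'; case: eqP => // ->.
rewrite big_fsetU1//= /A' eqxx muleC; congr (_ * _)%E.
apply: eq_big_seq => j jJ; case: eqP => // ji.
by move: iJ; rewrite -ji jJ.
Qed.

(** Cylinders are stable under intersection, and on them the identity is
    mutual independence.  Both sides are finite measures in C, so the identity
    extends to the sigma-algebra that cylinders generate. *)
Lemma past_independent t i C B : driving_time i = t -> driving i B ->
  (measurable : set_system (past t)) C -> P (C `&` B) = (P C * P B)%E.
Proof.
move=> it FB mC; have mB := driving_measurable FB.
have PB : P B = (fine (P B))%:E by rewrite fineK// fin_num_measure.
pose r := NngNum (fine_ge0 (measure_ge0 P B)).
have E : mrestr P mB C = mscale r P C.
  apply: (@g_sigma_algebra_measure_unique _ R Omega (past_cylinders t) _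
    (fun=> setT)) => //.
  - exact: past_cylinders_measurable.
  - by move=> _; exact: past_cylindersT.
  - by apply/seteqP; split=> // x _; exists 0%N.
  - exact: past_cylindersI.
  - move=> A cA; rewrite /= /mrestr /mscale/= -PB muleC.
    exact: past_cylinders_independent it FB cA.
  - move=> k; rewrite /= /mrestr (le_lt_trans (probability_le1 _ _)) ?ltry//.
    exact: measurableI.
by move: E; rewrite /mrestr /mscale/= -PB muleC.
Qed.

Lemma past_measurable_Z s j t : (s < t)%N ->
  measurable_fun (setT : set (past t)) (Z s j).
Proof.
move=> st _ B mB; apply: sub_sigma_algebra.
by apply: (@past_cylinders_sub (inl (s, j))) => //; exists B.
Qed.

Lemma past_measurable_eps s t : (s < t)%N ->
  measurable_fun (setT : set (past t)) (eps s).
Proof.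
move=> st _ B mB; apply: sub_sigma_algebra.
by apply: (@past_cylinders_sub (inr s)) => //; exists B.
Qed.

(** X_s reads only the driving variables of steps before s.  Silencing the later
    ones does not change X_s and makes the whole array measurable with respect
    to the past. *)
Lemma past_measurable_inar1 s t : (s <= t)%N ->
  measurable_fun (setT : set (past t)) (inar1 Z eps s).
Proof.
move=> st.
have mZ r j : measurable_fun (setT : set (past t)) (fun w => (r < t)%N && Z r j w).
  by case: ltnP => rt //=; exact: past_measurable_Z.
have me r : measurable_fun (setT : set (past t)) (fun w => if (r < t)%N then eps r w else 0%N).
  by case: ltnP => rt //=; exact: past_measurable_eps.
have := measurable_inar1 (fun r j => mfun_Sub (mem_set (mZ r j)))
  (fun r => mfun_Sub (mem_set (me r))) s.
congr (measurable_fun _ _); apply/funext => w.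
elim: s st => // s IH st; rewrite [LHS]/= [RHS]/= (IH (ltnW st)).
congr (_ + _)%N; last by rewrite -[LHS]/(if (s < t)%N then eps s w else 0%N) st.
by apply: eq_bigr => j _; rewrite -[LHS]/(nat_of_bool ((s < t)%N && Z s j w)) st.
Qed.

Lemma past_measurable t (X : Omega -> R) :
  measurable_fun (setT : set (past t)) X -> measurable_fun setT X.
Proof.
move=> mX _ B mB; have := mX measurableT B mB.
apply: smallest_sub => [|A]; last exact: past_cylinders_measurable.
split=> [|A mA|A mA]; [exact: measurable0|by rewrite setTD; exact: measurableC|].
exact: bigcupT_measurable.
Qed.

Lemma past_expectation_mul t i (X Y : Omega -> R) : driving_time i = t ->
  measurable_fun (setT : set (past t)) X ->
  (forall B, measurable B -> driving i (Y @^-1` B)) ->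
  P.-integrable setT (EFin \o X) -> P.-integrable setT (EFin \o Y) ->
  P.-integrable setT (EFin \o (fun w => X w * Y w)) /\
  \int[P]_w (X w * Y w) = (\int[P]_w X w) * (\int[P]_w Y w).
Proof.
move=> it mX mY; apply: independent_product => A B mA mB.
apply: past_independent it (mY _ mB) _.
by rewrite -[_ @^-1` _]setTI; exact: mX.
Qed.

End past.

(** * Integrability and expectation *)

Section integrability.
Context d (T : measurableType d) (R : realType) (P : probability T R).
Implicit Types X Y : T -> R.

Definition L1 X := P.-integrable setT (EFin \o X).

Lemma L1_measurable X : L1 X -> measurable_fun setT X.
Proof. by case/integrableP => /measurable_EFinP. Qed.

Lemma L1_cst (c : R) : L1 (fun=> c).
Proof. exact: finite_measure_integrable_cst. Qed.

Lemma L1_le X Y : measurable_fun setT X -> L1 Y -> (forall w, `|X w| <= Y w) -> L1 X.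
Proof.
move=> mX iY XY; apply: le_integrable iY => //; first exact/measurable_EFinP.
move=> w _ /=; rewrite lee_fin (le_trans (XY w))// ler_norm//.
Qed.

Lemma L1D X Y : L1 X -> L1 Y -> L1 (fun w => X w + Y w).
Proof. by move=> iX iY; apply: (integrableD _ iX iY). Qed.

Lemma L1B X Y : L1 X -> L1 Y -> L1 (fun w => X w - Y w).
Proof. by move=> iX iY; apply: (integrableB _ iX iY). Qed.

Lemma L1Z c X : L1 X -> L1 (fun w => c * X w).
Proof. by move=> iX; apply: (integrableZl _ c iX). Qed.

Lemma L1_norm X : L1 X -> L1 (fun w => `|X w|).
Proof. by move=> iX; apply: (integrable_norm iX). Qed.

Lemma L1_bounded X c : measurable_fun setT X -> (forall w, `|X w| <= c) -> L1 X.
Proof. by move=> mX Xc; apply: L1_le (L1_cst c) Xc. Qed.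

Lemma L1_sum n (F : nat -> T -> R) : (forall s, (s < n)%N -> L1 (F s)) ->
  L1 (fun w => \sum_(s < n) F s w).
Proof.
move=> iF; elim: n iF => [|n IH] iF.
  by under eq_fun do rewrite big_ord0; exact: L1_cst.
under eq_fun do rewrite big_ord_recr/=.
by apply: L1D; [apply: IH => s sn; apply: iF; rewrite ltnW|exact: iF].
Qed.

Lemma expect_cst (c : R) : \int[P]_w c = c.
Proof. by rewrite /Rintegral integral_cst//= probability_setT mule1. Qed.

Lemma expect_sum n (F : nat -> T -> R) : (forall s, (s < n)%N -> L1 (F s)) ->
  \int[P]_w (\sum_(s < n) F s w) = \sum_(s < n) \int[P]_w F s w.
Proof.
move=> iF; elim: n iF => [|n IH] iF.
  by under eq_Rintegral do rewrite big_ord0; rewrite expect_cst big_ord0.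
under eq_Rintegral do rewrite big_ord_recr/=.
have iF' s : (s < n)%N -> L1 (F s) by move=> sn; apply: iF; rewrite ltnW.
by rewrite RintegralD// ?big_ord_recr ?IH//; [exact: L1_sum|exact: iF].
Qed.

Lemma expect_le X Y : L1 X -> L1 Y -> (forall w, X w <= Y w) ->
  \int[P]_w X w <= \int[P]_w Y w.
Proof. by move=> iX iY XY; apply: le_Rintegral. Qed.

Lemma expect_norm_le X Y : measurable_fun setT X -> L1 Y ->
  (forall w, `|X w| <= Y w) -> `|\int[P]_w X w| <= \int[P]_w Y w.
Proof.
move=> mX iY XY; have iX := L1_le mX iY XY.
apply: le_trans (le_normr_Rintegral _ iX) _ => //.
by apply: expect_le => //; exact: L1_norm.
Qed.

Lemma expect_EFin X : L1 X -> (\int[P]_w X w)%:E = (\int[P]_w (X w)%:E)%E.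
Proof. by move=> iX; rewrite /Rintegral fineK//; exact: integrable_fin_num. Qed.

Lemma L1_ge0 X : measurable_fun setT X -> (forall w, 0 <= X w) ->
  (\int[P]_w (X w)%:E < +oo)%E -> L1 X.
Proof.
move=> mX X0 Xoo; apply/integrableP; split; first exact/measurable_EFinP.
rewrite (eq_integral (fun w => (X w)%:E))// => w _.
by rewrite /= ger0_norm.
Qed.

End integrability.

(** * Moments of the innovation distribution *)

Lemma measurable_nat_comp d (T : measurableType d) (R : realType)
    (f : nat -> R) (X : T -> nat) :
  measurable_fun setT X -> measurable_fun setT (fun w => f (X w)).
Proof. by move=> mX; exact: (measurableT_comp (f := f)). Qed.

Section innovation_moments.
Context (R : realType) (G : probability nat R).
Hypothesis G3 : ('E_G[fun k => (k%:R ^+ 3)%R] < +oo)%E.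

(** k^i <= 1 + k^3 for i <= 3. *)
Lemma L1_monomial i : (i <= 3)%N -> L1 G (fun k => k%:R ^+ i).
Proof.
move=> i3; have h3 : L1 G (fun k => k%:R ^+ 3).
  apply: L1_ge0 => //.
  by have := G3; rewrite expectation.unlock.
apply: (@L1_le _ _ _ _ _ (fun k => 1 + k%:R ^+ 3)) => //.
  by apply: L1D => //; exact: L1_cst.
move=> k; rewrite ger0_norm ?exprn_ge0//.
have [->|k0] := eqVneq k 0%N.
  by case: i {i3} => [|i]; rewrite ?expr0 ?expr0n/= ?addr0 ?lerDl.
have : k%:R ^+ i <= k%:R ^+ 3 :> R by apply: ler_weXn2l => //; rewrite ler1n lt0n.
by move/le_trans; apply; rewrite lerDr.
Qed.

Lemma L1_nat : L1 G (fun k => k%:R).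
Proof. by have := L1_monomial (isT : (1 <= 3)%N). Qed.

Lemma mean_of_expect : \int[G]_k k%:R = mean_of G.
Proof. by rewrite /mean_of unlock. Qed.

Lemma mean_of_ge0 : 0 <= mean_of G.
Proof. by rewrite -mean_of_expect Rintegral_ge0. Qed.

Lemma L1_center : L1 G (fun k => k%:R - mean_of G).
Proof. by apply: L1B L1_nat _; exact: L1_cst. Qed.

Lemma L1_center_cube : L1 G (fun k => `|k%:R - mean_of G| ^+ 3).
Proof.
set m := mean_of G; have m0 : 0 <= m := mean_of_ge0.
apply: (@L1_le _ _ _ _ _ (fun k => (k%:R ^+ 3 + (3 * m) * k%:R ^+ 2) +
    ((3 * m ^+ 2) * k%:R ^+ 1 + m ^+ 3))) => //.
  apply: L1D; first by apply: L1D; [|apply: L1Z]; exact: L1_monomial.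
  by apply: L1D; [apply: L1Z; exact: L1_monomial|exact: L1_cst].
move=> k; rewrite ger0_norm ?exprn_ge0//.
rewrite [leRHS](_ : _ = (k%:R + m) ^+ 3); last by ring.
apply: lerXn2r; rewrite ?nnegrE ?addr_ge0//.
by apply: le_trans (ler_normB _ _) _; rewrite !ger0_norm.
Qed.

Lemma L1_center_sqr : L1 G (fun k => (k%:R - mean_of G) ^+ 2).
Proof.
apply: (@L1_le _ _ _ _ _ (fun k => 1 + `|k%:R - mean_of G| ^+ 3)) => //.
  by apply: L1D L1_center_cube; exact: L1_cst.
move=> k; rewrite ger0_norm ?sqr_ge0//.
rewrite -[X in X <= _]real_normK ?num_real//; set x := `|_ - _|.
have x0 : 0 <= x := normr_ge0 _.
have [x1|x1] := leP x 1; first by nra.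
by have := ltW x1; nra.
Qed.

Lemma expect_center : \int[G]_k (k%:R - mean_of G) = 0.
Proof.
rewrite (RintegralB measurableT L1_nat (L1_cst G _)).
by rewrite mean_of_expect expect_cst subrr.
Qed.

Lemma variance_of_expect : \int[G]_k ((k%:R - mean_of G) ^+ 2) = variance_of G.
Proof.
by rewrite /variance_of /variance covariance.unlock /mean_of expectation.unlock.
Qed.

Lemma expect_ge_atom (f : nat -> R) k : L1 G f -> (forall k, 0 <= f k) ->
  f k * pmf_of G k <= \int[G]_k f k.
Proof.
move=> iF f0.
have i1 : L1 G (fun j => f k * (\1_[set k] j)).
  apply: L1Z; exact: integrable_indic.
have <- : \int[G]_j (f k * (\1_[set k] j)) = f k * pmf_of G k.
  rewrite RintegralZl//; last exact: integrable_indic.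
  by rewrite /Rintegral integral_indic// setIT.
apply: expect_le => // j; rewrite indicE; have [|_] := boolP (j \in _).
  by rewrite inE => ->; rewrite mulr1.
by rewrite mulr0.
Qed.

Hypothesis HG : innovation_assumption G.

Lemma pmf_of_gt0 k : (k <= 1)%N -> 0 < pmf_of G k.
Proof.
move=> k1; suff : support_of G k by [].
by case: HG => [[M [M1 ->]]|[-> _ _]] //=; exact: leq_trans M1.
Qed.

Lemma mean_of_gt0 : 0 < mean_of G.
Proof.
rewrite -mean_of_expect.
by apply: lt_le_trans (@expect_ge_atom _ 1 L1_nat _); rewrite // mul1r pmf_of_gt0.
Qed.

(** Both 0 and 1 are atoms.  The atom at 0 lies at a positive distance from the
    mean, since the atom at 1 makes the mean positive. *)
Lemma variance_of_gt0 : 0 < variance_of G.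
Proof.
rewrite -variance_of_expect.
apply: lt_le_trans (@expect_ge_atom _ 0 L1_center_sqr _); last by move=> k; exact: sqr_ge0.
rewrite mulr_gt0 ?pmf_of_gt0// sub0r sqrrN exprn_gt0//.
exact: mean_of_gt0.
Qed.

End innovation_moments.

(** * Random walk, population and departures *)

Section process.
Context (R : realType) (G : probability nat R) (d : measure_display)
  (Omega : measurableType d) (Z : nat -> nat -> {mfun Omega >-> bool})
  (eps : nat -> {mfun Omega >-> nat}).

Definition noise s w : R := (eps s w)%:R - mean_of G.
Definition population s w : R := (inar1 Z eps s w)%:R.
(** The process without departures is the random walk with drift; this is its
    centred part. *)
Definition walk s w : R := \sum_(r < s) noise r w.
(** The number of individuals that do not survive the thinning of step s + 1,
    computed from the balance X_(s+1) = X_s - departures + innovation. *)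
Definition departures s w : R := population s w + (eps s w)%:R - population s.+1 w.
Definition total_departures s w : R := \sum_(r < s) departures r w.

Lemma departuresE s w : departures s w = \sum_(j < inar1 Z eps s w) (~~ Z s j w)%:R.
Proof.
rewrite /departures /population /= natrD opprD addrACA subrr addr0 natr_sum.
rewrite -[X in X%:R]card_ord -sumr_const -sumrB.
by apply: eq_bigr => j _; case: (Z s j w); rewrite ?subrr ?subr0.
Qed.

Lemma departures_ge0 s w : 0 <= departures s w.
Proof. by rewrite departuresE sumr_ge0. Qed.

Lemma total_departures_ge0 s w : 0 <= total_departures s w.
Proof. by apply: sumr_ge0 => r _; exact: departures_ge0. Qed.

(** The whole analysis rests on this splitting: drift and walk are those of
    theta = 1, and total departures stay bounded in expectation when 1 - theta
    is of order n^(-2). *)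
Lemma populationE s w : population s w = walk s w + mean_of G * s%:R - total_departures s w.
Proof.
elim: s => [|s IH]; first by rewrite /population/= /walk /total_departures !big_ord0 mulr0 addr0 subr0.
rewrite /walk /total_departures !big_ord_recr/= -/(walk s w) -/(total_departures s w).
rewrite -natr1 /departures IH /noise; ring.
Qed.

Lemma population_ge0 s w : 0 <= population s w. Proof. by []. Qed.

Lemma population_le s w : population s w <= walk s w + mean_of G * s%:R.
Proof. by rewrite populationE lerBlDr lerDl total_departures_ge0. Qed.

Lemma measurable_population s : measurable_fun setT (population s).
Proof.
exact: (measurable_nat_comp (fun k => k%:R) (measurable_inar1 Z eps s)).
Qed.

Lemma measurable_noise s : measurable_fun setT (noise s).
Proof.
by apply: (measurable_nat_comp (fun k => k%:R - mean_of G)).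
Qed.

Lemma measurable_walk s : measurable_fun setT (walk s).
Proof. by apply: measurable_sum => r; exact: measurable_noise. Qed.

Lemma measurable_departures s : measurable_fun setT (departures s).
Proof.
apply: measurable_funB (measurable_population _); apply: measurable_funD (measurable_population _) _.
by apply: (measurable_nat_comp (fun k => k%:R)).
Qed.

Lemma past_measurable_population s t : (s <= t)%N ->
  measurable_fun (setT : set (past Z eps t)) (population s).
Proof.
move=> st.
exact: (@measurable_nat_comp _ (past Z eps t) R (fun k => k%:R) _ (past_measurable_inar1 st)).
Qed.

Lemma past_measurable_noise s t : (s < t)%N ->
  measurable_fun (setT : set (past Z eps t)) (noise s).
Proof.
move=> st.
exact: (@measurable_nat_comp _ (past Z eps t) R (fun k => k%:R - mean_of G) _
  (past_measurable_eps st)).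
Qed.

Lemma past_measurable_walk t : measurable_fun (setT : set (past Z eps t)) (walk t).
Proof.
by apply: measurable_sum => r; exact: past_measurable_noise.
Qed.

Lemma past_measurable_total_departures t :
  measurable_fun (setT : set (past Z eps t)) (total_departures t).
Proof.
rewrite (_ : total_departures t = fun w => walk t w + mean_of G * t%:R - population t w); last first.
  by apply/funext => w; rewrite populationE; ring.
apply: measurable_funB; last exact: past_measurable_population.
by apply: measurable_funD => //; exact: past_measurable_walk.
Qed.

End process.

Section process_law.
Context (R : realType) (G : probability nat R) (d : measure_display)
  (Omega : measurableType d) (Z : nat -> nat -> {mfun Omega >-> bool})
  (eps : nat -> {mfun Omega >-> nat}) (P : probability Omega R) (theta : R).
Hypothesis theta01 : 0 <= theta <= 1.
Hypothesis law : inar1_law Z eps G theta P.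
Hypothesis G3 : ('E_G[fun k => (k%:R ^+ 3)%R] < +oo)%E.

Notation noise := (noise G eps).
Notation walk := (walk G eps).
Notation population := (population R Z eps).
Notation departures := (departures R Z eps).
Notation total_departures := (total_departures R Z eps).
Notation mu := (mean_of G).
Notation sg2 := (variance_of G).

Lemma L1_eps (f : nat -> R) s : L1 G f -> L1 P (fun w => f (eps s w)).
Proof.
move=> /integrableP[_ fG]; apply/integrableP; split.
  by apply/measurable_EFinP; by apply: measurable_nat_comp.
rewrite -(ge0_integral_distribution (P := P) (eps s) (f := fun k => `|(f k)%:E|%E))//.
by rewrite (eq_measure_integral G)// => A mA _; exact: (innovation_law law).
Qed.

Lemma expect_eps (f : nat -> R) s : L1 G f ->
  \int[P]_w f (eps s w) = \int[G]_k f k.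
Proof.
move=> iF; rewrite /Rintegral.
rewrite -(integral_distribution (X := eps s) (f := fun k => (f k)%:E) _ (L1_eps s iF))//.
by congr fine; apply: eq_measure_integral => A mA _; exact: (innovation_law law).
Qed.

Lemma L1_noise s : L1 P (noise s).
Proof. exact: L1_eps (L1_center G3). Qed.

Lemma expect_noise s : \int[P]_w noise s w = 0.
Proof. by rewrite /noise (expect_eps _ (L1_center G3)) expect_center. Qed.

Lemma L1_noise_sqr s : L1 P (fun w => noise s w ^+ 2).
Proof. exact: L1_eps (L1_center_sqr G3). Qed.

Lemma expect_noise_sqr s : \int[P]_w (noise s w ^+ 2) = sg2.
Proof. by rewrite /noise (expect_eps _ (L1_center_sqr G3)) variance_of_expect. Qed.

(** The innovation of step t + 1 is independent of the history before it; this
    kills the cross terms both in the variance of the walk and in the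
    replacement argument for the central limit theorem. *)
Lemma expect_past_eps t (X : Omega -> R) (f : nat -> R) :
  measurable_fun (setT : set (past Z eps t)) X -> L1 P X -> L1 G f ->
  L1 P (fun w => X w * f (eps t w)) /\
  \int[P]_w (X w * f (eps t w)) = (\int[P]_w X w) * (\int[G]_k f k).
Proof.
move=> mX iX iF; rewrite -(expect_eps t iF).
apply: (past_expectation_mul (driving_independent law) (i := inr t)) => //.
  move=> B mB; exists (f @^-1` B) => //; first by rewrite setTI.
exact: L1_eps.
Qed.

(** |X| <= 1 + X^2. *)
Lemma L1_of_sqr (X : Omega -> R) : measurable_fun setT X ->
  L1 P (fun w => X w ^+ 2) -> L1 P X.
Proof.
move=> mX iX; apply: (@L1_le _ _ _ _ _ (fun w => 1 + X w ^+ 2)) => //.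
  by apply: L1D iX; exact: L1_cst.
move=> w; rewrite ler_norml; have := sqr_ge0 (X w - 1).
have := sqr_ge0 (X w + 1) => ? ?; apply/andP; split; nra.
Qed.

(** The walk and its next increment are uncorrelated, so variances add up. *)
Lemma walk_moments t : L1 P (fun w => walk t w ^+ 2) /\
  \int[P]_w (walk t w ^+ 2) = sg2 * t%:R.
Proof.
elim: t => [|t [iM EM]].
  rewrite (_ : (fun w => _) = fun=> 0); last by apply/funext => w; rewrite /walk big_ord0 expr0n.
  by rewrite expect_cst mulr0; split => //; exact: L1_cst.
have iW := L1_of_sqr (measurable_walk G eps t) iM.
have [iC EC] := expect_past_eps (past_measurable_walk G (t := t)) iW (L1_center G3).
have E : (fun w => walk t.+1 w ^+ 2) =
    (fun w => walk t w ^+ 2 + 2 * (walk t w * noise t w) + noise t w ^+ 2).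
  by apply/funext => w; rewrite /walk big_ord_recr/= -/(walk t w); ring.
have i1 : L1 P (fun w => walk t w ^+ 2 + 2 * (walk t w * noise t w)).
  by apply: L1D => //; exact: L1Z.
rewrite E; split; first by apply: L1D => //; exact: L1_noise_sqr.
rewrite (RintegralD measurableT i1 (L1_noise_sqr t)).
rewrite (RintegralD measurableT iM (L1Z _ iC)) (RintegralZl _ measurableT iC).
by rewrite EC EM expect_center// expect_noise_sqr -natr1; ring.
Qed.

Lemma L1_walk t : L1 P (walk t).
Proof. exact: L1_of_sqr (measurable_walk G eps t) (walk_moments t).1. Qed.

Lemma L1_population t : L1 P (population t).
Proof.
apply: (@L1_le _ _ _ _ _ (fun w => walk t w + mu * t%:R)) => //.
- exact: measurable_population.
- by apply: L1D (L1_walk t) _; exact: L1_cst.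
- by move=> w; rewrite ger0_norm ?population_ge0//; exact: population_le.
Qed.

Lemma expect_population_le t : \int[P]_w population t w <= mu * t%:R.
Proof.
have iB := L1D (L1_walk t) (L1_cst P (mu * t%:R)).
apply: le_trans (expect_le (L1_population t) iB (population_le G Z eps t)) _.
rewrite (RintegralD measurableT (L1_walk t) (L1_cst P _)) expect_cst.
rewrite /walk (expect_sum (fun s _ => L1_noise s)) big1 ?add0r// => s _.
exact: expect_noise.
Qed.

Lemma population_sqr_le t w : population t w ^+ 2 <= 2 * walk t w ^+ 2 + 2 * (mu * t%:R) ^+ 2.
Proof.
have := population_le G Z eps t w; have := population_ge0 R Z eps t w.
have := sqr_ge0 (walk t w - mu * t%:R).
by move: (population _ _) (walk _ _) => x y; nra.
Qed.

Lemma L1_population_sqr t : L1 P (fun w => population t w ^+ 2).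
Proof.
apply: (@L1_le _ _ _ _ _ (fun w => 2 * walk t w ^+ 2 + 2 * (mu * t%:R) ^+ 2)) => //.
- by apply: measurable_funX; exact: measurable_population.
- by apply: L1D (L1_cst P _); apply: L1Z; exact: (walk_moments t).1.
- by move=> w; rewrite ger0_norm ?sqr_ge0//; exact: population_sqr_le.
Qed.

Lemma expect_population_sqr_le t :
  \int[P]_w (population t w ^+ 2) <= 2 * (sg2 + mu ^+ 2) * t%:R ^+ 2.
Proof.
have [iM EM] := walk_moments t.
have i2 := L1Z 2 iM.
have iB := L1D i2 (L1_cst P (2 * (mu * t%:R) ^+ 2)).
apply: le_trans (expect_le (L1_population_sqr t) iB (population_sqr_le t)) _.
rewrite (RintegralD measurableT i2 (L1_cst P _)) expect_cst.
rewrite (RintegralZl _ measurableT iM) EM.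
have v0 : 0 <= sg2 by rewrite -variance_of_expect Rintegral_ge0// => k _; exact: sqr_ge0.
have : t%:R <= t%:R ^+ 2 :> R.
  by rewrite -natrX ler_nat; case: (t) => // k; rewrite expnS expn1 leq_pmulr.
by move: (t%:R) => x; nra.
Qed.

Lemma expect_departure_indicator s j : L1 P (fun w => (~~ Z s j w)%:R) /\
  \int[P]_w (~~ Z s j w)%:R = 1 - theta.
Proof.
have mS : measurable (Z s j @^-1` [set false]).
  by rewrite -[X in measurable X]setTI; exact: measurable_funP.
rewrite (_ : (fun w => _) = \1_(Z s j @^-1` [set false])); last first.
  apply/funext => w; rewrite indicE; congr ((nat_of_bool _)%:R).
  by apply/idP/idP; rewrite inE/=; case: (Z s j w).
have PZ : P (Z s j @^-1` [set false]) = (1 - theta)%:E.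
  transitivity (bernoulli_prob theta [set false]).
    exact: (thinning_law law s j [set false]).
  by rewrite /bernoulli_prob theta01 fsbig_set1.
split; first exact: integrable_indic.
by rewrite /Rintegral integral_indic// setIT; rewrite [X in fine X]PZ.
Qed.

(** A random number of summands is handled as a series whose j-th term is
    switched on by the event j < X_t, which belongs to the past. *)
Lemma departures_series (g : nat -> R) t w : (forall k, 0 <= g k) ->
  (\sum_(j <oo) (g (inar1 Z eps t w) * (j < inar1 Z eps t w)%:R * (~~ Z t j w)%:R)%:E)%E
  = (g (inar1 Z eps t w) * departures t w)%:E.
Proof.
move=> g0; set k := inar1 Z eps t w.
rewrite (nneseries_split _ k); last by move=> j _; rewrite lee_fin !mulr_ge0.
rewrite add0n [X in (_ + X)%E]eseries0 ?adde0; last first.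
  by move=> j kj _; rewrite ltnNge kj/= mulr0 mul0r.
rewrite sumEFin departuresE mulr_sumr big_mkord; congr EFin.
by apply: eq_bigr => j _; rewrite ltn_ord mulr1.
Qed.

Lemma population_series (g : nat -> R) t w : (forall k, 0 <= g k) ->
  (\sum_(j <oo) (g (inar1 Z eps t w) * (j < inar1 Z eps t w)%:R)%:E)%E
  = (g (inar1 Z eps t w) * population t w)%:E.
Proof.
move=> g0; set k := inar1 Z eps t w.
rewrite (nneseries_split _ k); last by move=> j _; rewrite lee_fin !mulr_ge0.
rewrite add0n [X in (_ + X)%E]eseries0 ?adde0; last first.
  by move=> j kj _; rewrite ltnNge kj/= mulr0.
rewrite sumEFin big_mkord; congr EFin.
under eq_bigr do rewrite ltn_ord mulr1.
by rewrite sumr_const card_ord -mulr_natr.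
Qed.

(** Given X_t, each of the X_t individuals leaves with probability 1 - theta.
    Termwise integration of the two series reduces this to the independence of
    a single thinning variable from the past. *)
Lemma expect_departures (g : nat -> R) t : (forall k, 0 <= g k) ->
  L1 P (fun w => g (inar1 Z eps t w)) ->
  L1 P (fun w => g (inar1 Z eps t w) * population t w) ->
  L1 P (fun w => g (inar1 Z eps t w) * departures t w) /\
  \int[P]_w (g (inar1 Z eps t w) * departures t w) =
    (1 - theta) * \int[P]_w (g (inar1 Z eps t w) * population t w).
Proof.
move=> g0 ig ix.
pose X := inar1 Z eps t.
pose h i w : R := g (X w) * (i < X w)%:R.
pose b i w : R := (~~ Z t i w)%:R.
have mh j : measurable_fun (setT : set (past Z eps t)) (h j).
  exact: (@measurable_nat_comp _ (past Z eps t) R (fun k => g k * (j < k)%:R) _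
    (past_measurable_inar1 (leqnn t))).
have ih j : L1 P (h j).
  apply: L1_le (past_measurable (mh j)) ig _ => w.
  by rewrite ger0_norm ?mulr_ge0// ler_piMr//; case: (_ < _)%N.
have hb j : L1 P (fun w => h j w * b j w) /\
    \int[P]_w (h j w * b j w) = (\int[P]_w h j w) * (1 - theta).
  have [ib <-] := expect_departure_indicator t j.
  apply: (past_expectation_mul (driving_independent law) (i := inl (t, j))) => //; last exact: ih.
  by move=> B mB; exists ((fun c : bool => (~~ c)%:R) @^-1` B); rewrite ?setTI.
have hbE : forall j, (\int[P]_w (h j w * b j w)%:E = (1 - theta)%:E * \int[P]_w (h j w)%:E)%E.
  by move=> j; rewrite -!expect_EFin//; [rewrite (hb j).2 mulrC EFinM|exact: (hb j).1].
have E : (\int[P]_w (g (X w) * departures t w)%:E =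
    (1 - theta)%:E * \int[P]_w (g (X w) * population t w)%:E)%E.
  under eq_integral do rewrite -(departures_series t _ g0).
  under [in RHS]eq_integral do rewrite -(population_series t _ g0).
  rewrite !integral_nneseries//.
  - rewrite -nneseriesZl; first by apply: eq_eseriesr => j _; exact: hbE.
    by move=> j _; apply: integral_ge0 => w _; rewrite lee_fin mulr_ge0.
  - by move=> j; apply/measurable_EFinP; exact: L1_measurable (ih j).
  - by move=> j w _; rewrite lee_fin mulr_ge0.
  - by move=> j; apply/measurable_EFinP; exact: L1_measurable (hb j).1.
  - by move=> j w _; rewrite lee_fin !mulr_ge0.
rewrite -(expect_EFin ix) -EFinM in E.
split; last by rewrite /Rintegral E.
apply: L1_ge0; last by rewrite E ltry.
- by apply: measurable_funM (L1_measurable ig) _; exact: measurable_departures.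
- by move=> w; rewrite mulr_ge0// departures_ge0.
Qed.

End process_law.

(** * Euclidean norms of finite sequences *)

Section euclidean_norm.
Context {R : realType}.
Implicit Types u v : nat -> R.

Definition l2 n u := Num.sqrt (\sum_(s < n) u s ^+ 2).

Lemma l2_ge0 n u : 0 <= l2 n u. Proof. exact: sqrtr_ge0. Qed.

Lemma sqr_l2 n u : l2 n u ^+ 2 = \sum_(s < n) u s ^+ 2.
Proof. by rewrite sqr_sqrtr// sumr_ge0// => s _; exact: sqr_ge0. Qed.

Lemma l2S n u : l2 n.+1 u = Num.sqrt (l2 n u ^+ 2 + u n ^+ 2).
Proof. by rewrite sqr_l2 /l2 big_ord_recr. Qed.

(** The triangle inequality in the plane, from (A b - a B)^2 >= 0. *)
Lemma minkowski_pair (A B a b : R) : 0 <= A -> 0 <= B ->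
  Num.sqrt ((A + B) ^+ 2 + (a + b) ^+ 2) <=
  Num.sqrt (A ^+ 2 + a ^+ 2) + Num.sqrt (B ^+ 2 + b ^+ 2).
Proof.
move=> A0 B0.
have Aa : 0 <= A ^+ 2 + a ^+ 2 by rewrite addr_ge0 ?sqr_ge0.
have Bb : 0 <= B ^+ 2 + b ^+ 2 by rewrite addr_ge0 ?sqr_ge0.
set p := Num.sqrt (A ^+ 2 + a ^+ 2); set q := Num.sqrt (B ^+ 2 + b ^+ 2).
have p0 : 0 <= p by exact: sqrtr_ge0.
have q0 : 0 <= q by exact: sqrtr_ge0.
have p2 : p ^+ 2 = A ^+ 2 + a ^+ 2 by rewrite sqr_sqrtr.
have q2 : q ^+ 2 = B ^+ 2 + b ^+ 2 by rewrite sqr_sqrtr.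
rewrite -[leRHS]ger0_norm ?addr_ge0// -sqrtr_sqr ler_sqrt ?sqr_ge0//.
suff : A * B + a * b <= p * q by nra.
apply: le_trans (ler_norm _) _.
rewrite -[leRHS]ger0_norm ?mulr_ge0// -ler_sqr ?nnegrE// !real_normK ?num_real//.
by rewrite [leRHS]exprMn p2 q2; have := sqr_ge0 (A * b - a * B); nra.
Qed.

Lemma l2D n u v : l2 n (fun s => u s + v s) <= l2 n u + l2 n v.
Proof.
elim: n => [|n IH]; first by rewrite /l2 !big_ord0 sqrtr0 addr0.
rewrite !l2S; apply: le_trans (minkowski_pair _ _ (l2_ge0 n u) (l2_ge0 n v)).
rewrite ler_sqrt ?addr_ge0 ?sqr_ge0// lerD2r.
by apply: lerXn2r IH; rewrite nnegrE ?addr_ge0 ?l2_ge0.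
Qed.

Lemma eq_l2 n u v : u =1 v -> l2 n u = l2 n v.
Proof. by move=> uv; rewrite /l2; under eq_bigr do rewrite uv. Qed.

Lemma l2B n u v : l2 n (fun s => u s - v s) <= l2 n u + l2 n v.
Proof.
apply: le_trans (l2D n u (fun s => - v s)) _; rewrite lerD2l.
by rewrite /l2; under eq_bigr do rewrite sqrrN.
Qed.

Lemma l2_dist n u v : `|l2 n u - l2 n v| <= l2 n (fun s => u s - v s).
Proof.
rewrite ler_norml lerBlDl; apply/andP; split.
  rewrite lerNl opprB lerBlDl.
  rewrite (eq_l2 n (v := fun s => u s - (u s - v s))); first exact: l2B.
  by move=> s; ring.
rewrite (eq_l2 n (v := fun s => v s + (u s - v s))); first exact: l2D.
by move=> s; ring.
Qed.

Lemma l2_le_sum n u : l2 n u <= \sum_(s < n) `|u s|.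
Proof.
elim: n => [|n IH]; first by rewrite /l2 !big_ord0 sqrtr0.
rewrite l2S big_ord_recr/=; apply: (@le_trans _ _ (l2 n u + `|u n|)); last by rewrite lerD2r.
rewrite -[leRHS]ger0_norm ?addr_ge0 ?l2_ge0// -sqrtr_sqr ler_sqrt ?sqr_ge0//.
rewrite -[X in _ + X]real_normK ?num_real//.
by have := mulr_ge0 (l2_ge0 n u) (normr_ge0 (u n)); nra.
Qed.

(** Linearizes the square root, so that a second moment controls the expected
    norm; c is later chosen as the order of magnitude of the norm. *)
Lemma l2_amgm n u (c : R) : 0 < c -> l2 n u <= (\sum_(s < n) u s ^+ 2 / c + c) / 2.
Proof.
move=> c0; rewrite -mulr_suml -sqr_l2 ler_pdivlMr//.
rewrite -subr_ge0; set y := l2 n u.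
rewrite (_ : _ - _ = (y - c) ^+ 2 / c); first by rewrite divr_ge0 ?sqr_ge0 ?ltW.
by field; rewrite gt_eqF.
Qed.

Lemma l2_eq0 n u : l2 n u = 0 -> forall s, (s < n)%N -> u s = 0.
Proof.
move=> u0 s sn; have := sqr_l2 n u; rewrite u0 expr0n/= => /esym/eqP.
rewrite psumr_eq0; last by move=> i _; exact: sqr_ge0.
by move=> /allP/(_ (Ordinal sn)); rewrite mem_index_enum => /(_ isT); rewrite /= sqrf_eq0 => /eqP.
Qed.

End euclidean_norm.

(** * Comparison of the statistic with a weighted sum of innovations *)

Section decomposition.
Context (R : realType) (G : probability nat R) (d : measure_display)
  (Omega : measurableType d) (Z : nat -> nat -> {mfun Omega >-> bool})
  (eps : nat -> {mfun Omega >-> nat}).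

Notation noise := (noise G eps).
Notation walk := (walk G eps).
Notation population := (population R Z eps).
Notation departures := (departures R Z eps).
Notation total_departures := (total_departures R Z eps).
Notation mu := (mean_of G).
Notation sg2 := (variance_of G).
Notation sg := (Num.sqrt (variance_of G)).

(** The norm of the deterministic profile 0, 1, ..., n - 1 which the population
    follows up to the factor mu. *)
Definition ramp n : R := l2 n (fun s => s%:R).

(** The numerator of the estimation error of theta. *)
Definition score n w : R := \sum_(s < n) population s w * (population s.+1 w - population s w - mu).

(** The leading part of the statistic, in which X_s is replaced by its drift
    mu s; the weights s / ramp n form a unit vector. *)
Definition weighted_noise n w : R := \sum_(s < n) s%:R / (ramp n * sg) * noise s w.

(** The random normalization of the statistic is moved to the other side of
    the inequality: tau <= x is score <= x sigma |X|, and dividing the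
    difference of the two sides by the deterministic quantity mu sigma ramp n
    makes it comparable with the weighted noise. *)
Definition pivot n (x : R) w : R :=
  (score n w - x * sg * l2 n (population^~ w)) / (mu * sg * ramp n) + x.

Lemma tauE n w : tau Z eps G n w =
  (score n w / l2 n (population^~ w) ^+ 2) / Num.sqrt (sg2 * (l2 n (population^~ w) ^+ 2)^-1).
Proof.
rewrite /tau /dickey_fuller /theta_ols sqr_l2 !big_add1/= !big_mkord.
set D := \sum_(i < n) _ ^+ 2.
have [D0|D0] := eqVneq D 0; first by rewrite D0 invr0 !mulr0 sqrtr0 invr0 !mulr0.
congr (_ / _); rewrite -[X in _ - X](divff D0) -mulrBl; congr (_ / _).
rewrite /D -sumrB; apply: eq_bigr => s _.
by rewrite expr2 -mulrBr; congr (_ * _); exact: addrAC.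
Qed.

Lemma measurable_weighted_noise n : measurable_fun setT (weighted_noise n).
Proof.
apply: measurable_sum => s; apply: measurable_funM => //.
exact: measurable_noise.
Qed.

Lemma measurable_pivot n x : measurable_fun setT (pivot n x).
Proof.
have mc s : measurable_fun setT (population s) := measurable_population Z eps s.
apply: measurable_funD => //; apply: measurable_funM => //; apply: measurable_funB.
  apply: measurable_sum => s; apply: measurable_funM => //.
  by apply: measurable_funB => //; apply: measurable_funB.
apply: measurable_funM => //.
have msqrt : measurable_fun setT (@Num.sqrt R).
  by apply: continuous_measurable_fun; exact: sqrt_continuous.
apply: (measurableT_comp msqrt).
by apply: measurable_sum => s; apply: measurable_funX.
Qed.

Hypothesis mu_gt0 : 0 < mu.
Hypothesis sg2_gt0 : 0 < sg2.

(** When the path vanishes up to time n - 1, tau is 0 by convention, while the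
    pivot equals x exactly.  The strict inequality on one side and the large
    one on the other therefore absorb the degenerate case. *)
Lemma pivot_lt_tau n x w : 0 < ramp n ->
  (pivot n x w < x -> tau Z eps G n w < x) /\
  (tau Z eps G n w <= x -> pivot n x w <= x).
Proof.
move=> rn; have sg_gt0 : 0 < sg by rewrite sqrtr_gt0.
have c0 : 0 < mu * sg * ramp n by rewrite !mulr_gt0.
rewrite /pivot gtrDr gerDr pmulr_llt0 ?invr_gt0// pmulr_lle0 ?invr_gt0//.
have := l2_ge0 n (population^~ w); rewrite le_eqVlt => /predU1P[q0|q0].
  have S0 : score n w = 0.
    rewrite /score big1// => s _.
    by rewrite (l2_eq0 (esym q0) (ltn_ord s)) mul0r.
  by rewrite S0 -q0 mulr0 subrr ltxx; split.
rewrite subr_lt0 subr_le0 tauE.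
have -> : Num.sqrt (sg2 * (l2 n (population^~ w) ^+ 2)^-1) = sg / l2 n (population^~ w).
  by rewrite sqrtrM ?ltW// -exprVn sqrtr_sqr ger0_norm// invr_ge0 ltW.
set q := l2 n _ in q0 *.
have -> : score n w / q ^+ 2 / (sg / q) = score n w / (sg * q).
  by field; rewrite !gt_eqF.
rewrite ltr_pdivrMr ?mulr_gt0// ler_pdivrMr ?mulr_gt0// mulrA.
by split.
Qed.

(** Telescoping of M_(s+1)^2 = M_s^2 + 2 M_s xi_s + xi_s^2.  The
    right-hand side is bounded in L^1 by second moments of its terms, so the
    variance of the sum is not needed. *)
Lemma sum_walk_noise n w :
  \sum_(s < n) walk s w * noise s w =
  (walk n w ^+ 2 - \sum_(s < n) noise s w ^+ 2) / 2.
Proof.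
elim: n => [|n IH]; first by rewrite /walk !big_ord0 expr0n subr0 mul0r.
rewrite !big_ord_recr/= IH /walk big_ord_recr/= -/(walk n w).
by field.
Qed.

(** Replacing X_s by mu s in the score costs three terms: walk against noise,
    departures against noise, population against departures. *)
Definition score_error n w : R :=
  (walk n w ^+ 2 + \sum_(s < n) noise s w ^+ 2) / 2 +
  \sum_(s < n) total_departures s w * `|noise s w| +
  \sum_(s < n) population s w * departures s w.

(** The distance of the path from its drift is at most the norm of the walk,
    linearized with c = n, plus the l1 norm of the departures. *)
Definition norm_error n w : R :=
  (\sum_(s < n) walk s w ^+ 2 / n%:R + n%:R) / 2 + \sum_(s < n) total_departures s w.

Lemma score_error_bound n w :
  `|score n w - mu * \sum_(s < n) s%:R * noise s w| <= score_error n w.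
Proof.
have -> : score n w - mu * (\sum_(s < n) s%:R * noise s w) =
    \sum_(s < n) walk s w * noise s w - \sum_(s < n) total_departures s w * noise s w -
    \sum_(s < n) population s w * departures s w.
  rewrite /score mulr_sumr -!sumrB; apply: eq_bigr => s _.
  have -> : population s.+1 w - population s w - mu = noise s w - departures s w.
    by rewrite /departures /noise; ring.
  by rewrite (populationE G Z eps s w); ring.
apply: le_trans (ler_normB _ _) _; apply: lerD; last first.
  rewrite ger0_norm// sumr_ge0// => s _.
  by rewrite mulr_ge0 ?population_ge0 ?departures_ge0.
apply: le_trans (ler_normB _ _) _; apply: lerD.
  rewrite sum_walk_noise normrM [X in _ * X]ger0_norm ?invr_ge0// ler_wpM2r ?invr_ge0//.
  apply: le_trans (ler_normB _ _) _.
  by rewrite !ger0_norm ?sqr_ge0// sumr_ge0// => s _; exact: sqr_ge0.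
apply: le_trans (ler_norm_sum _ _ _) _; apply: ler_sum => s _.
by rewrite normrM (ger0_norm (total_departures_ge0 _ _ _ _ _)).
Qed.

Lemma norm_error_bound n w : (0 < n)%N ->
  `|l2 n (population^~ w) - mu * ramp n| <= norm_error n w.
Proof.
move=> n0.
have -> : mu * ramp n = l2 n (fun s => mu * s%:R).
  rewrite /ramp /l2 -[mu in LHS]ger0_norm ?(ltW mu_gt0)// -sqrtr_sqr -sqrtrM ?sqr_ge0//.
  by rewrite mulr_sumr; under eq_bigr do rewrite -exprMn.
apply: le_trans (l2_dist _ _ _) _.
rewrite (eq_l2 n (v := fun s => walk s w - total_departures s w)); last first.
  by move=> s; rewrite (populationE G); ring.
apply: le_trans (l2B _ _ _) _; apply: lerD; first by apply: l2_amgm; rewrite ltr0n.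
apply: le_trans (l2_le_sum _ _) _; apply: ler_sum => s _.
by rewrite ger0_norm// total_departures_ge0.
Qed.

Lemma pivot_error_bound n x w : (0 < n)%N -> 0 < ramp n ->
  `|pivot n x w - weighted_noise n w| <=
  (score_error n w + `|x| * sg * norm_error n w) / (mu * sg * ramp n).
Proof.
move=> n0 rn; have sg_gt0 : 0 < sg by rewrite sqrtr_gt0.
have c0 : 0 < mu * sg * ramp n by rewrite !mulr_gt0.
have -> : weighted_noise n w = (mu * \sum_(s < n) s%:R * noise s w) / (mu * sg * ramp n).
  rewrite /weighted_noise mulr_sumr mulr_suml; apply: eq_bigr => s _.
  by field; rewrite !gt_eqF.
have -> : pivot n x w - mu * (\sum_(s < n) s%:R * noise s w) / (mu * sg * ramp n) =
    ((score n w - mu * \sum_(s < n) s%:R * noise s w) -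
     x * sg * (l2 n (population^~ w) - mu * ramp n)) / (mu * sg * ramp n).
  by rewrite /pivot; field; rewrite !gt_eqF.
rewrite normrM [X in _ * X]ger0_norm ?invr_ge0 ?(ltW c0)// ler_wpM2r ?invr_ge0 ?(ltW c0)//.
apply: le_trans (ler_normB _ _) _; apply: lerD; first exact: score_error_bound.
rewrite !normrM (ger0_norm (ltW sg_gt0)) ler_wpM2l ?mulr_ge0 ?(ltW sg_gt0)//.
exact: norm_error_bound.
Qed.

End decomposition.

Lemma sum_le_const (R : realType) n (F : nat -> R) (c : R) :
  (forall s, (s < n)%N -> F s <= c) -> \sum_(s < n) F s <= c * n%:R.
Proof.
move=> Fc; rewrite mulr_natr -[X in _ *+ X]card_ord -sumr_const.
by apply: ler_sum => s _; exact: Fc.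
Qed.

Section error_expectation.
Context (R : realType) (G : probability nat R) (d : measure_display)
  (Omega : measurableType d) (Z : nat -> nat -> {mfun Omega >-> bool})
  (eps : nat -> {mfun Omega >-> nat}) (P : probability Omega R) (theta h : R).
Hypothesis theta01 : 0 <= theta <= 1.
Hypothesis law : inar1_law Z eps G theta P.
Hypothesis G3 : ('E_G[fun k => (k%:R ^+ 3)%R] < +oo)%E.

Notation noise := (noise G eps).
Notation walk := (walk G eps).
Notation population := (population R Z eps).
Notation departures := (departures R Z eps).
Notation total_departures := (total_departures R Z eps).
Notation mu := (mean_of G).
Notation sg2 := (variance_of G).
Notation sg := (Num.sqrt (variance_of G)).
Notation score_error := (score_error G Z eps).
Notation norm_error := (norm_error G Z eps).

Let m1 := \int[G]_k `|k%:R - mean_of G|.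
Let k0 : 0 <= 1 - theta.
Proof. by case/andP: theta01 => _; rewrite subr_ge0. Qed.
Let mu0 : 0 <= mu := mean_of_ge0 G.

Lemma L1_departures s : L1 P (departures s).
Proof.
have := expect_departures theta01 law (g := fun=> 1) (t := s) (fun=> ler01) (L1_cst P 1).
under eq_fun do rewrite mul1r.
under [X in _ -> L1 P X /\ _]eq_fun do rewrite mul1r.
by move=> /(_ (L1_population law G3 s))[].
Qed.

Lemma expect_departures_le s : \int[P]_w departures s w <= (1 - theta) * (mu * s%:R).
Proof.
have := expect_departures theta01 law (g := fun=> 1) (t := s) (fun=> ler01) (L1_cst P 1).
under eq_fun do rewrite mul1r.
under [X in _ -> L1 P X /\ _]eq_fun do rewrite mul1r.
move=> /(_ (L1_population law G3 s))[_].
under eq_Rintegral do rewrite mul1r.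
by move=> ->; apply: ler_wpM2l => //; exact: (expect_population_le law G3 s).
Qed.

Lemma L1_total_departures s : L1 P (total_departures s).
Proof. by apply: L1_sum => r _; exact: L1_departures. Qed.

Variable n : nat.
Hypothesis n_gt0 : (0 < n)%N.
Hypothesis theta_near1 : (1 - theta) * n%:R ^+ 2 <= h.

(** Each step loses at most (1 - theta) mu n individuals on average, and there
    are n steps. *)
Lemma expect_total_departures_le s : (s <= n)%N -> \int[P]_w total_departures s w <= h * mu.
Proof.
move=> sn; rewrite (expect_sum (fun r _ => L1_departures r)).
apply: (@le_trans _ _ (\sum_(r < s) (1 - theta) * (mu * n%:R))).
  apply: ler_sum => r _; apply: le_trans (expect_departures_le r) _.
  by rewrite ler_wpM2l// ler_wpM2l// ler_nat ltnW// (leq_trans (ltn_ord r)).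
rewrite sumr_const card_ord -[_ *+ s]mulr_natr.
have sn' : s%:R <= n%:R :> R by rewrite ler_nat.
have km : 0 <= (1 - theta) * (mu * n%:R) by rewrite !mulr_ge0.
apply: le_trans (ler_wpM2l km sn') _.
apply: le_trans (ler_wpM2r mu0 theta_near1).
by rewrite le_eqVlt; apply/orP; left; apply/eqP; ring.
Qed.

Lemma expect_population_departures s : (s <= n)%N ->
  L1 P (fun w => population s w * departures s w) /\
  \int[P]_w (population s w * departures s w) <= 2 * h * (sg2 + mu ^+ 2).
Proof.
move=> sn.
have [iD ED] := expect_departures theta01 law (g := fun k => k%:R) (t := s)
  (fun=> ler0n _ _) (L1_population law G3 s) (L1_population_sqr law G3 s).
split; first exact: iD.
rewrite ED.
have v0 : 0 <= sg2 by rewrite -(variance_of_expect G) Rintegral_ge0// => k _; exact: sqr_ge0.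
apply: (@le_trans _ _ ((1 - theta) * (2 * (sg2 + mu ^+ 2) * n%:R ^+ 2))).
  apply: ler_wpM2l => //; apply: le_trans (expect_population_sqr_le law G3 s) _.
  apply: ler_wpM2l; first by rewrite mulr_ge0// addr_ge0// sqr_ge0.
  by apply: lerXn2r; rewrite ?nnegrE// ler_nat.
have : 0 <= 2 * (sg2 + mu ^+ 2) by rewrite mulr_ge0// addr_ge0// sqr_ge0.
move=> c0; have kh := ler_wpM2l c0 theta_near1.
by apply: le_trans (le_trans _ kh) _; rewrite le_eqVlt; apply/orP; left; apply/eqP; ring.
Qed.

Lemma expect_total_departures_noise s : (s <= n)%N ->
  L1 P (fun w => total_departures s w * `|noise s w|) /\
  \int[P]_w (total_departures s w * `|noise s w|) <= h * mu * m1.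
Proof.
move=> sn.
have [iX ->] := expect_past_eps law (past_measurable_total_departures G (t := s))
  (L1_total_departures s) (L1_norm (L1_center G3)).
split; first exact: iX.
apply: ler_wpM2r; first exact: Rintegral_ge0.
exact: expect_total_departures_le.
Qed.

Lemma expect_score_error : L1 P (score_error n) /\
  \int[P]_w score_error n w <= (sg2 + h * mu * m1 + 2 * h * (sg2 + mu ^+ 2)) * n%:R.
Proof.
have [iW EW] := walk_moments law G3 n.
have iN s : (s < n)%N -> L1 P (fun w => noise s w ^+ 2) by move=> _; exact: (L1_noise_sqr law G3 s).
have iTN s (sn : (s < n)%N) := (expect_total_departures_noise (ltnW sn)).1.
have iCD s (sn : (s < n)%N) := (expect_population_departures (ltnW sn)).1.
have i1 := L1D iW (L1_sum iN).
have i1' : L1 P (fun w => (walk n w ^+ 2 + \sum_(s < n) noise s w ^+ 2) / 2).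
  by under eq_fun do rewrite mulrC; exact: L1Z.
have i2 := L1D i1' (L1_sum iTN).
split; first exact: L1D i2 (L1_sum iCD).
rewrite (RintegralD measurableT i2 (L1_sum iCD)) (RintegralD measurableT i1' (L1_sum iTN)).
rewrite (RintegralZr _ measurableT i1) (RintegralD measurableT iW (L1_sum iN)) EW.
rewrite (expect_sum iN) (expect_sum iTN) (expect_sum iCD).
have -> : \sum_(s < n) \int[P]_w (noise s w ^+ 2) = sg2 * n%:R.
  under eq_bigr do rewrite (expect_noise_sqr law G3).
  by rewrite sumr_const card_ord mulr_natr.
rewrite [leRHS]mulrDl; apply: lerD; last first.
  apply: (sum_le_const (F := fun s => \int[P]_w (population s w * departures s w))) => s sn.
  exact: (expect_population_departures (ltnW sn)).2.
rewrite [leRHS]mulrDl; apply: lerD; first by lra.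
apply: (sum_le_const (F := fun s => \int[P]_w (total_departures s w * `|noise s w|))) => s sn.
exact: (expect_total_departures_noise (ltnW sn)).2.
Qed.

Lemma expect_norm_error : L1 P (norm_error n) /\
  \int[P]_w norm_error n w <= ((sg2 + 1) / 2 + h * mu) * n%:R.
Proof.
have nr0 : n%:R != 0 :> R by rewrite pnatr_eq0 -lt0n.
have iW s : (s < n)%N -> L1 P (fun w => walk s w ^+ 2 / n%:R).
  by move=> _; under eq_fun do rewrite mulrC; apply: L1Z; exact: (walk_moments law G3 s).1.
have iT s (_ : (s < n)%N) := L1_total_departures s.
have i1 := L1D (L1_sum iW) (L1_cst P n%:R).
have i1' : L1 P (fun w => (\sum_(s < n) walk s w ^+ 2 / n%:R + n%:R) / 2).
  by under eq_fun do rewrite mulrC; exact: L1Z.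
split; first exact: L1D i1' (L1_sum iT).
rewrite (RintegralD measurableT i1' (L1_sum iT)) (RintegralZr _ measurableT i1).
rewrite (RintegralD measurableT (L1_sum iW) (L1_cst P _)) expect_cst (expect_sum iW) (expect_sum iT).
rewrite [leRHS]mulrDl; apply: lerD; last first.
  apply: (sum_le_const (F := fun s => \int[P]_w total_departures s w)) => s sn.
  exact: expect_total_departures_le (ltnW sn).
rewrite [leRHS]mulrAC ler_wpM2r ?invr_ge0// [leRHS]mulrDl mul1r lerD2r.
apply: (sum_le_const (F := fun s => \int[P]_w (walk s w ^+ 2 / n%:R))) => s sn.
rewrite (RintegralZr _ measurableT (walk_moments law G3 s).1) (walk_moments law G3 s).2.
have v0 : 0 <= sg2 by rewrite -(variance_of_expect G) Rintegral_ge0// => k _; exact: sqr_ge0.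
rewrite ler_pdivrMr ?ltr0n//; apply: ler_wpM2l => //.
by rewrite ler_nat ltnW.
Qed.

Hypothesis mu_gt0 : 0 < mu.
Hypothesis sg2_gt0 : 0 < sg2.

(** Both errors are of order n in expectation, whereas the normalization
    ramp n is of order n^(3/2). *)
Definition pivot_error_cst (x : R) : R :=
  (sg2 + h * mu * m1 + 2 * h * (sg2 + mu ^+ 2) +
   `|x| * sg * ((sg2 + 1) / 2 + h * mu)) / (mu * sg).

Lemma L1_pivot_error x : 0 < ramp R n ->
  L1 P (fun w => `|pivot G Z eps n x w - weighted_noise G eps n w|).
Proof.
move=> rn; have [iS _] := expect_score_error; have [iN _] := expect_norm_error.
have i1 := L1D iS (L1Z (`|x| * sg) iN).
apply: L1_le (L1Z (mu * sg * ramp R n)^-1 i1) _ => [|w]; last first.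
  by rewrite normr_id mulrC; exact: pivot_error_bound.
apply: measurableT_comp => //; apply: measurable_funB.
  exact: measurable_pivot.
exact: measurable_weighted_noise.
Qed.

Lemma expect_pivot_error x : 0 < ramp R n ->
  \int[P]_w `|pivot G Z eps n x w - weighted_noise G eps n w| <=
    pivot_error_cst x * (n%:R / ramp R n).
Proof.
move=> rn; have sg_gt0 : 0 < sg by rewrite sqrtr_gt0.
have [iS ES] := expect_score_error; have [iN EN] := expect_norm_error.
have i1 := L1D iS (L1Z (`|x| * sg) iN).
have iB := L1Z (mu * sg * ramp R n)^-1 i1.
apply: le_trans (expect_le (L1_pivot_error x rn) iB _) _.
  by move=> w; rewrite mulrC; exact: pivot_error_bound.
rewrite (RintegralZl _ measurableT i1) (RintegralD measurableT iS (L1Z _ iN)).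
rewrite (RintegralZl _ measurableT iN) /pivot_error_cst.
rewrite [leRHS](_ : _ = (mu * sg * ramp R n)^-1 *
    ((sg2 + h * mu * m1 + 2 * h * (sg2 + mu ^+ 2)) * n%:R +
     `|x| * sg * (((sg2 + 1) / 2 + h * mu) * n%:R))); last first.
  by rewrite /m1; field; rewrite !gt_eqF.
rewrite ler_wpM2l ?invr_ge0 ?mulr_ge0 ?(ltW mu_gt0) ?(ltW sg_gt0) ?(ltW rn)//.
have xs0 : 0 <= `|x| * sg by rewrite mulr_ge0// ltW.
exact: lerD ES (ler_wpM2l xs0 EN).
Qed.

End error_expectation.

(** * Central limit estimate for weighted sums of innovations *)

Section weights.
Context {R : realType}.

Lemma telescope_bound n (e c : nat -> R) :
  (forall k, (k < n)%N -> `|e k.+1 - e k| <= c k) ->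
  `|e n - e 0%N| <= \sum_(k < n) c k.
Proof.
move=> ec; rewrite -(telescope_sumr e (leq0n n)) big_mkord.
apply: le_trans (ler_norm_sum _ _ _) _.
by apply: ler_sum => k _; exact: ec.
Qed.

Lemma sum_weights_le n (b : nat -> R) (m q : R) : 0 <= m ->
  \sum_(s < n) b s ^+ 2 = 1 -> (forall s, (s < n)%N -> 0 <= b s <= q) ->
  \sum_(s < n) (m * `|b s| ^+ 3 + b s ^+ 4) <= m * q + q ^+ 2.
Proof.
move=> m0 b1 bq; rewrite -[leRHS]mulr1 -b1 mulr_sumr; apply: ler_sum => s _.
have /andP[b0 bsq] := bq s (ltn_ord s).
rewrite ger0_norm// mulrDl; apply: lerD.
  rewrite -mulrA ler_wpM2l// exprS ler_wpM2r//; exact: sqr_ge0.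
rewrite (_ : b s ^+ 4 = b s ^+ 2 * b s ^+ 2); last by ring.
rewrite ler_wpM2r ?sqr_ge0//; apply: lerXn2r => //; rewrite nnegrE//.
exact: le_trans bsq.
Qed.

End weights.

Section central_limit.
Context (R : realType) (G : probability nat R) (d : measure_display)
  (Omega : measurableType d) (Z : nat -> nat -> {mfun Omega >-> bool})
  (eps : nat -> {mfun Omega >-> nat}) (P : probability Omega R) (theta : R).
Hypothesis law : inar1_law Z eps G theta P.
Hypothesis G3 : ('E_G[fun k => (k%:R ^+ 3)%R] < +oo)%E.
Hypothesis sg2_gt0 : 0 < variance_of G.

Notation mu := (mean_of G).
Notation sg := (Num.sqrt (variance_of G)).

Definition standardized (k : nat) : R := (k%:R - mu) / sg.
Definition third_abs_moment : R := \int[G]_k (`|standardized k| ^+ 3).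

Let sg_gt0 : 0 < sg. Proof. by rewrite sqrtr_gt0. Qed.

Lemma L1_standardized : L1 G standardized.
Proof. by rewrite /standardized; under eq_fun do rewrite mulrC; apply: L1Z; exact: L1_center. Qed.

Lemma expect_standardized : \int[G]_k standardized k = 0.
Proof.
by rewrite (RintegralZr _ measurableT (L1_center G3)) expect_center// mul0r.
Qed.

Lemma L1_standardized_sqr : L1 G (fun k => standardized k ^+ 2).
Proof.
rewrite /standardized; under eq_fun do rewrite exprMn mulrC.
by apply: L1Z; exact: L1_center_sqr.
Qed.

Lemma expect_standardized_sqr : \int[G]_k (standardized k ^+ 2) = 1.
Proof.
rewrite /standardized; under eq_Rintegral do rewrite exprMn.
rewrite (RintegralZr _ measurableT (L1_center_sqr G3)) variance_of_expect.
by rewrite exprVn sqr_sqrtr ?ltW// divff// gt_eqF.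
Qed.

Lemma L1_standardized_cube : L1 G (fun k => `|standardized k| ^+ 3).
Proof.
rewrite /standardized; under eq_fun do rewrite normrM exprMn mulrC.
by apply: L1Z; exact: L1_center_cube.
Qed.

Lemma third_abs_moment_ge0 : 0 <= third_abs_moment.
Proof. by apply: Rintegral_ge0 => k _; rewrite exprn_ge0. Qed.

Variables (n : nat) (b : nat -> R).
Hypothesis b_unit : \sum_(s < n) b s ^+ 2 = 1.

Definition partial_sum k w : R := \sum_(s < k) b s * standardized (eps s w).

Lemma past_measurable_partial_sum k :
  measurable_fun (setT : set (past Z eps k)) (partial_sum k).
Proof.
apply: measurable_sum => s; apply: measurable_funM => //.
exact: (@measurable_nat_comp _ (past Z eps k) R standardized _
  (past_measurable_eps (ltn_ord s))).
Qed.

Lemma measurable_of_derive (f f' : R -> R) :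
  (forall x : R, is_derive x 1 f (f' x)) -> measurable_fun setT f.
Proof.
move=> ff'; apply: continuous_measurable_fun => x.
exact: is_derive_continuous (ff' x).
Qed.

Lemma past_measurable_comp k (f : R -> R) z : measurable_fun setT f ->
  measurable_fun (setT : set (past Z eps k)) (fun w => f (z - partial_sum k w)).
Proof.
move=> mf; apply: measurableT_comp => //; apply: measurable_funB => //.
exact: past_measurable_partial_sum.
Qed.

Variables (dl z : R).
Hypothesis dl_gt0 : 0 < dl.

(** The Gaussian variance still present after k summands have been introduced:
    all of 1 + dl^2 at the start, dl^2 at the end. *)
Definition remaining_variance k : R := dl ^+ 2 + (1 - \sum_(s < k) b s ^+ 2).

Lemma remaining_variance_ge k : (k <= n)%N -> dl ^+ 2 <= remaining_variance k.
Proof.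
move=> kn; rewrite /remaining_variance lerDl subr_ge0 -b_unit -(subnKC kn).
rewrite big_split_ord/= lerDl; apply: sumr_ge0 => s _; exact: sqr_ge0.
Qed.

(** The k-th Gaussian increment is exchanged for the k-th innovation.  The
    linear and the quadratic terms of the replacement estimate are products of
    a function of the past with a centred function of the innovation. *)
Lemma heat_telescope_step k : (k < n)%N ->
  `|\int[P]_w heat (remaining_variance k.+1) (z - partial_sum k.+1 w) -
    \int[P]_w heat (remaining_variance k) (z - partial_sum k w)| <=
  heat_cst dl * (third_abs_moment * `|b k| ^+ 3 + b k ^+ 4).
Proof.
move=> kn; set v := remaining_variance k.+1.
have dlv : dl ^+ 2 <= v by exact: remaining_variance_ge.
have -> : remaining_variance k = v + b k ^+ 2.
  by rewrite /v /remaining_variance big_ord_recr/=; ring.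
pose u w := standardized (eps k w).
pose y w := z - partial_sum k w.
have E1 w : z - partial_sum k.+1 w = y w - b k * u w.
  by rewrite /partial_sum big_ord_recr/= /y opprD addrA.
have mh c : measurable_fun setT (fun x : R => heat c x).
  exact: measurable_of_derive (is_derive_heat_x c).
have mhx c : measurable_fun setT (fun x : R => heat_x c x).
  exact: measurable_of_derive (is_derive_heat_xx c).
have mhxx c : measurable_fun setT (fun x : R => heat_xx c x).
  exact: measurable_of_derive (is_derive_heat_xxx c).
have ih c m : L1 P (fun w => heat c (z - partial_sum m w)).
  apply: (@L1_bounded _ _ _ _ _ 1); first exact: past_measurable (past_measurable_comp z (mh c)).
  by move=> w; have /andP[h0 h1] := heat_bounds c (z - partial_sum m w); rewrite ger0_norm.
have ihx : L1 P (fun w => heat_x v (y w)).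
  apply: L1_bounded; first exact: past_measurable (past_measurable_comp z (mhx v)).
  by move=> w; exact: heat_x_bound.
have ihxx : L1 P (fun w => heat_xx v (y w)).
  apply: L1_bounded; first exact: past_measurable (past_measurable_comp z (mhxx v)).
  by move=> w; exact: heat_xx_bound.
have [ix Ex] := expect_past_eps law (past_measurable_comp z (mhx v)) ihx L1_standardized.
have i21 := L1B L1_standardized_sqr (L1_cst G 1).
have [ixx Exx] := expect_past_eps law (past_measurable_comp z (mhxx v)) ihxx i21.
rewrite expect_standardized mulr0 in Ex.
rewrite (RintegralB measurableT L1_standardized_sqr (L1_cst G 1)) in Exx.
rewrite expect_standardized_sqr expect_cst subrr mulr0 in Exx.
have iA := L1B (ih v k.+1) (ih (v + b k ^+ 2) k).
have iB := L1D iA (L1Z (b k) ix).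
have iC := L1B iB (L1Z (b k ^+ 2 / 2) ixx).
have iD := L1D (L1Z (`|b k| ^+ 3) (L1_eps law k L1_standardized_cube)) (L1_cst P (b k ^+ 4)).
have <- : \int[P]_w (heat v (z - partial_sum k.+1 w) - heat (v + b k ^+ 2) (z - partial_sum k w) +
     b k * (heat_x v (y w) * u w) - b k ^+ 2 / 2 * (heat_xx v (y w) * (u w ^+ 2 - 1)))
  = \int[P]_w heat v (z - partial_sum k.+1 w) - \int[P]_w heat (v + b k ^+ 2) (z - partial_sum k w).
  rewrite (RintegralB measurableT iB (L1Z _ ixx)) (RintegralD measurableT iA (L1Z _ ix)).
  rewrite (RintegralB measurableT (ih _ _) (ih _ _)).
  rewrite (RintegralZl _ measurableT ix) (RintegralZl _ measurableT ixx).
  by rewrite Ex Exx !mulr0 addr0 subr0.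
have -> : third_abs_moment * `|b k| ^+ 3 + b k ^+ 4 =
    \int[P]_w (`|b k| ^+ 3 * `|u w| ^+ 3 + b k ^+ 4).
  rewrite (RintegralD measurableT (L1Z _ (L1_eps law k L1_standardized_cube)) (L1_cst P _)).
  rewrite expect_cst (RintegralZl _ measurableT (L1_eps law k L1_standardized_cube)).
  by rewrite (expect_eps law k L1_standardized_cube) mulrC.
rewrite -(RintegralZl _ measurableT iD).
apply: expect_norm_le (L1_measurable iC) (L1Z _ iD) _ => w.
have := heat_step (b k) (u w) (y w) dl_gt0 dlv.
rewrite E1 -/(y w) -/(u w) normrM; congr (`|_| <= _); last first.
  by rewrite (exprMn _ `|b k|).
by move: (heat _ _) (heat _ _) (heat_x _ _) (heat_xx _ _) => *; ring.
Qed.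

Variable q : R.
Hypothesis b_small : forall s, (s < n)%N -> 0 <= b s <= q.

(** Summing the replacement errors, at most q times the squared weights, which
    add up to 1. *)
Lemma gaussian_smoothing_bound :
  `|\int[P]_w Phi ((z - partial_sum n w) / dl) - Phi (z * isqrt (dl ^+ 2 + 1))| <=
  heat_cst dl * (third_abs_moment * q + q ^+ 2).
Proof.
have -> : Phi (z * isqrt (dl ^+ 2 + 1)) =
    \int[P]_w heat (remaining_variance 0) (z - partial_sum 0 w).
  rewrite /remaining_variance big_ord0 subr0.
  under eq_Rintegral do rewrite /partial_sum big_ord0 subr0.
  by rewrite expect_cst.
have -> : \int[P]_w Phi ((z - partial_sum n w) / dl) =
    \int[P]_w heat (remaining_variance n) (z - partial_sum n w).
  rewrite /remaining_variance b_unit subrr addr0.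
  by rewrite /heat /isqrt sqrtr_sqr ger0_norm// ltW.
have bnd := telescope_bound (e := fun k => \int[P]_w heat (remaining_variance k)
  (z - partial_sum k w)) heat_telescope_step.
apply: le_trans bnd _; rewrite -mulr_sumr.
apply: ler_wpM2l; first exact: heat_cst_ge0.
exact: sum_weights_le third_abs_moment_ge0 b_unit b_small.
Qed.

End central_limit.

(** * Tails and continuity of the Gaussian distribution function *)

Section gaussian_tails.
Context {R : realType}.

Lemma Phi_nat_cvg1 : @Phi R n%:R @[n --> \oo] --> (1 : R).
Proof.
pose F n : set (measurableTypeR R) := `]-oo, n%:R]%classic.
have FT : \bigcup_n F n = setT.
  rewrite -subTset => t _; exists (Num.truncn t).+1 => //=.
  by rewrite /F/= in_itv/= ltW// truncnS_gt.
have : normal_prob 0 1 (F n) @[n --> \oo] --> (1 : \bar R)%E.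
  rewrite -(probability_setT (normal_prob (0:R) 1)) -FT.
  apply: nondecreasing_cvg_mu.
  - by move=> n; exact: measurable_itv.
  - by rewrite FT.
  - move=> n m nm; apply/subsetPset => x; rewrite /F/= !in_itv/= => /le_trans.
    by apply; rewrite ler_nat.
by move/fine_cvg.
Qed.

Lemma Phi_Nnat_cvg0 : @Phi R (- n%:R) @[n --> \oo] --> (0 : R).
Proof.
pose F n : set (measurableTypeR R) := `]-oo, - n%:R]%classic.
have F0 : \bigcap_n F n = set0.
  rewrite -subset0 => t /(_ (Num.bound `|t|) I).
  rewrite /F/= in_itv/= leNgt => /negP; apply; rewrite ltrNl.
  by rewrite (le_lt_trans (ler_norm _))// normrN archi_boundP.
have : normal_prob 0 1 (F n) @[n --> \oo] --> (0 : \bar R)%E.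
  rewrite -(measure0 (normal_prob (0:R) 1)) -F0.
  apply: nonincreasing_cvg_mu.
  - by rewrite (le_lt_trans (probability_le1 _ _)) ?ltry//; exact: measurable_itv.
  - by move=> n; exact: measurable_itv.
  - by rewrite F0.
  - move=> m n mn; apply/subsetPset => x; rewrite /F/= !in_itv => /le_trans; apply.
    by rewrite lerN2 ler_nat.
by move/fine_cvg.
Qed.

Lemma Phi_tails (e : R) : 0 < e -> exists K : R, 1 - Phi K < e /\ Phi (- K) < e.
Proof.
move=> e0.
have [n [h1 h2]] : exists n, `|1 - @Phi R n%:R| < e /\ `|0 - @Phi R (- n%:R)| < e.
  have : \forall n \near \oo, `|1 - @Phi R n%:R| < e /\ `|0 - @Phi R (- n%:R)| < e.
    near=> n; split; near: n.
      by move/cvgrPdist_lt : Phi_nat_cvg1; apply.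
    by move/cvgrPdist_lt : Phi_Nnat_cvg0; apply.
  by move=> [N _ HN]; exists N; apply: HN => /=.
exists n%:R; split; first by apply: le_lt_trans h1; exact: ler_norm.
by move: h2; rewrite sub0r normrN ger0_norm ?Phi_ge0.
Unshelve. all: end_near. Qed.

(** Phi takes every value in ]0, 1[ by the intermediate value theorem, and the
    partial inverse is then a right inverse. *)
Lemma Phi_inv_cancel (alpha : R) : 0 < alpha < 1 -> Phi (Phi_inv alpha) = alpha.
Proof.
move=> /andP[a0 a1]; apply: pinvK; rewrite inE/=.
have [K [K1 K2]] := Phi_tails (e := Num.min alpha (1 - alpha)) ltac:(by rewrite lt_min a0 subr_gt0).
have KK : - `|K| <= `|K| by rewrite ge0_cp// ?normr_ge0.
have l1 : Phi (- `|K|) <= alpha.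
  apply: (@le_trans _ _ (Phi (- K))); first by apply: Phi_homo; rewrite lerN2 ler_norm.
  by apply/ltW/(lt_le_trans K2); rewrite ge_min lexx.
have l2 : alpha <= Phi `|K|.
  apply: (@le_trans _ _ (Phi K)); last by apply: Phi_homo; rewrite ler_norm.
  have : 1 - Phi K < 1 - alpha by apply: (lt_le_trans K1); rewrite ge_min lexx orbT.
  by lra.
have [||c _ cE] := @IVT R (@Phi R) (- `|K|) `|K| alpha KK.
- by apply: continuous_subspaceT; exact: continuous_Phi.
- by rewrite ge_min le_max l1 l2 orbT.
by exists c.
Qed.

(** Shifting by K dl and inflating the variance by dl^2 is harmless for small
    dl, by continuity. *)
Lemma Phi_smoothed_cvg (x K e : R) : 0 < e -> exists dl, 0 < dl /\
  (`|Phi ((x + K * dl) * isqrt (dl ^+ 2 + 1)) - Phi x| < e /\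
   `|Phi ((x - K * dl) * isqrt (dl ^+ 2 + 1)) - Phi x| < e).
Proof.
move=> e0.
have c1 : isqrt (dl ^+ 2 + 1) @[dl --> (0:R)] --> (1:R).
  have E : isqrt (0 * 0 + 1) = 1 :> R by rewrite mul0r add0r /isqrt sqrtr1 invr1.
  have cs : {for (0:R) * 0 + 1, continuous isqrt}.
    by apply: is_derive_continuous (is_derive_isqrt _); rewrite mul0r add0r.
  rewrite -[X in _ --> X]E.
  have cq : {for (0:R), continuous (fun dl : R => dl * dl + 1)}.
    exact: (is_derive_continuous (is_deriveD_fun (is_deriveM_fun (is_derive_id_fun 0)
      (is_derive_id_fun 0)) (is_derive_cst_fun 1 0))).
  exact: (@cvg_comp _ _ _ (fun dl : R => dl * dl + 1) isqrt _ _ _ cq cs).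
have c2 c : Phi ((x + c * dl) * isqrt (dl ^+ 2 + 1)) @[dl --> (0:R)] --> Phi x.
  have cP : {for x, continuous (@Phi R)} := is_derive_continuous (is_derive_Phi x).
  have cq : {for (0:R), continuous (fun dl : R => x + c * dl)}.
    exact: (is_derive_continuous (is_deriveD_fun (is_derive_cst_fun x 0)
      (is_deriveM_fun (is_derive_cst_fun c 0) (is_derive_id_fun 0)))).
  have cg : (x + c * dl) * isqrt (dl ^+ 2 + 1) @[dl --> (0:R)] --> x.
    rewrite -[X in _ --> X]mulr1; apply: cvgM c1.
    by rewrite -[X in _ --> X]addr0 -[X in _ + X](mulr0 c); exact: cq.
  exact: (@cvg_comp _ _ _ (fun dl : R => (x + c * dl) * isqrt (dl ^+ 2 + 1))
    (@Phi R) _ _ _ cg cP).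
have : \forall dl \near (0:R)^'+, 0 < dl /\
  (`|Phi ((x + K * dl) * isqrt (dl ^+ 2 + 1)) - Phi x| < e /\
   `|Phi ((x - K * dl) * isqrt (dl ^+ 2 + 1)) - Phi x| < e).
  near=> dl; split; first by near: dl; exact: nbhs_right_gt.
  split; near: dl; apply: cvg_within.
    by move/cvgrPdistC_lt : (c2 K); apply.
  by move/cvgrPdistC_lt : (c2 (- K)) => /(_ _ e0); under eq_near do rewrite mulNr.
by move=> /filter_ex [dl ?]; exists dl.
Unshelve. all: end_near. Qed.

End gaussian_tails.

(** * From smoothed expectations back to probabilities *)

Section sandwich.
Context d (T : measurableType d) (R : realType) (P : probability T R).
Implicit Types Y V : T -> R.

Lemma heat_sqr (dl y : R) : 0 < dl -> heat (dl ^+ 2) y = Phi (y / dl).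
Proof. by move=> dl0; rewrite /heat /isqrt sqrtr_sqr ger0_norm// ltW. Qed.

Lemma Phi_scaled_lipschitz (dl x y : R) : 0 < dl ->
  `|Phi (x / dl) - Phi (y / dl)| <= `|x - y| / dl.
Proof.
move=> dl0; rewrite -!heat_sqr//; apply: le_trans (heat_lipschitz _ _ _) _.
by rewrite mulrC /isqrt sqrtr_sqr (ger0_norm (ltW dl0)).
Qed.

Lemma L1_Phi (dl z : R) V : measurable_fun setT V -> L1 P (fun w => Phi ((z - V w) / dl)).
Proof.
move=> mV; apply: (@L1_bounded _ _ _ _ _ 1); last first.
  by move=> w; rewrite ger0_norm ?Phi_ge0 ?Phi_le1.
have mPhi : measurable_fun setT (@Phi R).
  by apply: continuous_measurable_fun; exact: continuous_Phi.
apply: (measurableT_comp mPhi); apply: measurable_funM => //.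
exact: measurable_funB.
Qed.

Lemma expect_indic (A : set T) : measurable A -> \int[P]_w (\1_A w) = fine (P A).
Proof. by move=> mA; rewrite /Rintegral integral_indic// setIT. Qed.

Variables (Y V : T -> R) (x K dl : R).
Hypothesis mV : measurable_fun setT V.
Hypothesis iYV : L1 P (fun w => `|Y w - V w|).
Hypothesis dl_gt0 : 0 < dl.

(** The indicator of Y <= x is at most Phi ((x + K dl - Y) / dl) + 1 - Phi K,
    and Phi (_ / dl) is Lipschitz, so Y may be replaced by V. *)
Lemma probability_le_smoothed (E : set T) : measurable E ->
  (forall w, E w -> Y w <= x) ->
  fine (P E) <= \int[P]_w Phi ((x + K * dl - V w) / dl) +
    (\int[P]_w `|Y w - V w|) / dl + (1 - Phi K).
Proof.
move=> mE EY; rewrite -expect_indic//.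
have i1 := L1_Phi dl (x + K * dl) mV.
have i2 : L1 P (fun w => `|Y w - V w| / dl).
  by under eq_fun do rewrite mulrC; exact: L1Z.
have i3 := L1D (L1D i1 i2) (L1_cst P (1 - Phi K)).
have iE : L1 P (\1_E) by exact: integrable_indic.
apply: le_trans (expect_le iE i3 _) _ => [w|]; last first.
  rewrite (RintegralD measurableT (L1D i1 i2) (L1_cst P _)) (RintegralD measurableT i1 i2).
  by rewrite expect_cst (RintegralZr _ measurableT iYV).
have P0 := Phi_ge0 ((x + K * dl - V w) / dl); have PK := Phi_le1 K.
have YV0 : 0 <= `|Y w - V w| / dl by rewrite divr_ge0// ltW.
rewrite indicE; have [wE|_] := boolP (w \in E); rewrite /=; last by lra.
have Yx : Y w <= x by apply: EY; rewrite inE in wE.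
have KY : Phi K <= Phi ((x + K * dl - Y w) / dl).
  by apply: Phi_homo; rewrite ler_pdivlMr//; lra.
have := Phi_scaled_lipschitz (x + K * dl - Y w) (x + K * dl - V w) dl_gt0.
rewrite (_ : x + K * dl - Y w - _ = - (Y w - V w)); last by ring.
by rewrite normrN => /(le_trans (ler_norm _)); lra.
Qed.

Lemma probability_ge_smoothed (E : set T) : measurable E ->
  (forall w, Y w < x -> E w) ->
  \int[P]_w Phi ((x - K * dl - V w) / dl) -
    (\int[P]_w `|Y w - V w|) / dl - Phi (- K) <= fine (P E).
Proof.
move=> mE EY; rewrite -expect_indic//.
have i1 := L1_Phi dl (x - K * dl) mV.
have i2 : L1 P (fun w => `|Y w - V w| / dl).
  by under eq_fun do rewrite mulrC; exact: L1Z.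
have i3 := L1B (L1B i1 i2) (L1_cst P (Phi (- K))).
have iE : L1 P (\1_E) by exact: integrable_indic.
apply: le_trans (expect_le i3 iE _) => [|w].
  rewrite (RintegralB measurableT (L1B i1 i2) (L1_cst P _)) (RintegralB measurableT i1 i2).
  by rewrite expect_cst (RintegralZr _ measurableT iYV).
have P1 := Phi_le1 ((x - K * dl - V w) / dl); have PK := Phi_ge0 (- K).
have YV0 : 0 <= `|Y w - V w| / dl by rewrite divr_ge0// ltW.
rewrite indicE; have [_|wE] := boolP (w \in E); rewrite /=; first by lra.
have Yx : x <= Y w.
  by rewrite leNgt; apply/negP => /EY wE'; move: wE; rewrite notin_setE.
have KY : Phi ((x - K * dl - Y w) / dl) <= Phi (- K).
  by apply: Phi_homo; rewrite ler_pdivrMr//; lra.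
have := Phi_scaled_lipschitz (x - K * dl - V w) (x - K * dl - Y w) dl_gt0.
rewrite (_ : x - K * dl - V w - _ = Y w - V w); last by ring.
by move=> /(le_trans (ler_norm _)); lra.
Qed.

End sandwich.

Section ramp.
Context {R : realType}.

Lemma sqr_ramp n : ramp R n ^+ 2 * 6 = n%:R * (n%:R - 1) * (2 * n%:R - 1).
Proof.
rewrite /ramp sqr_l2; elim: n => [|n IH]; first by rewrite big_ord0 !mul0r.
by rewrite big_ord_recr/= mulrDl IH -natr1; ring.
Qed.

Lemma sqr_ramp_ge n : (2 <= n)%N -> n%:R ^+ 3 <= 12 * ramp R n ^+ 2.
Proof.
move=> n2; have : 2 <= n%:R :> R by rewrite (ler_nat _ 2).
have := sqr_ramp n; move: (n%:R) (ramp R n ^+ 2) => y r E y2.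
rewrite (_ : 12 * r = 2 * (r * 6)); last by ring.
(* 2 y (y - 1) (2 y - 1) - y^3 = y (3 y - 2) (y - 2) + 2 y (y - 1) *)
have : 0 <= y * (3 * y - 2) * (y - 2) by rewrite !mulr_ge0//; lra.
by rewrite E; nra.
Qed.

Lemma ramp_gt0 n : (2 <= n)%N -> 0 < ramp R n.
Proof.
move=> n2; rewrite lt_neqAle sqrtr_ge0 andbT eq_sym; apply/negP => /eqP r0.
have := sqr_ramp_ge n2; rewrite r0 expr0n mulr0 leNgt exprn_gt0//.
by rewrite ltr0n (leq_trans _ n2).
Qed.

Lemma ratio_small (e : R) : 0 < e ->
  \forall n \near \oo, [/\ (2 <= n)%N, 0 < ramp R n & n%:R / ramp R n < e].
Proof.
move=> e0; near=> n.
have n2 : (2 <= n)%N by near: n; exact: nbhs_infty_ge.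
have r0 := ramp_gt0 n2.
have n0 : 0 < n%:R :> R by rewrite ltr0n (leq_trans _ n2).
split => //; rewrite ltr_pdivrMr// -ltr_sqr ?nnegrE ?mulr_ge0 ?ltW// exprMn.
have h1 : 12 / e ^+ 2 < n%:R by near: n; exact: nbhs_infty_gtr.
rewrite ltr_pdivrMr ?exprn_gt0// in h1.
have h2 := sqr_ramp_ge n2.
have : n%:R ^+ 2 * 12 < n%:R ^+ 2 * (n%:R * e ^+ 2) by rewrite ltr_pM2l// exprn_gt0.
rewrite (_ : _ * (_ * e ^+ 2) = e ^+ 2 * n%:R ^+ 3); last by ring.
have := ler_wpM2l (sqr_ge0 e) h2.
by move: (n%:R) (ramp R n ^+ 2) => y r; lra.
Unshelve. all: end_near. Qed.

End ramp.

(** * The limit of the statistic *)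

Section dickey_fuller_limit.
Context (R : realType) (G : probability nat R) (d : measure_display)
  (Omega : measurableType d) (Z : nat -> nat -> {mfun Omega >-> bool})
  (eps : nat -> {mfun Omega >-> nat}).
Hypothesis G3 : ('E_G[fun k => (k%:R ^+ 3)%R] < +oo)%E.
Hypothesis HG : innovation_assumption G.

Notation ratio n := (n%:R / ramp R n).

Let mu_gt0 : 0 < mean_of G := mean_of_gt0 G3 HG.
Let sg2_gt0 : 0 < variance_of G := variance_of_gt0 G3 HG.

Lemma ramp_weights n : 0 < ramp R n ->
  \sum_(s < n) (s%:R / ramp R n) ^+ 2 = 1 /\
  forall s, (s < n)%N -> 0 <= s%:R / ramp R n <= ratio n.
Proof.
move=> r0; split.
  under eq_bigr do rewrite exprMn.
  by rewrite -mulr_suml -sqr_l2 -exprMn divff ?expr1n// gt_eqF.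
move=> s sn; rewrite divr_ge0 ?(ltW r0)//= ler_wpM2r ?invr_ge0 ?(ltW r0)//.
by rewrite ler_nat ltnW.
Qed.

Lemma weighted_noiseE n w : 0 < ramp R n ->
  weighted_noise G eps n w = partial_sum G eps (fun s => s%:R / ramp R n) n w.
Proof.
move=> r0; apply: eq_bigr => s _; rewrite /standardized /noise.
by field; rewrite !gt_eqF// sqrtr_gt0.
Qed.

Definition approximation_error (h x dl q : R) : R :=
  heat_cst dl * (third_abs_moment G * q + q ^+ 2) + pivot_error_cst G h x * q / dl.

(** Combines the smoothing of E at scale dl, the distance between pivot and
    weighted noise, and the Gaussian estimate for the latter. *)
Lemma event_probability_bound (P : probability Omega R) (theta h : R) n
    (E : set Omega) (x K dl : R) :
  0 <= theta <= 1 -> inar1_law Z eps G theta P ->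
  (0 < n)%N -> 0 < ramp R n -> (1 - theta) * n%:R ^+ 2 <= h -> 0 < dl ->
  measurable E ->
  (forall w, pivot G Z eps n x w < x -> E w) ->
  (forall w, E w -> pivot G Z eps n x w <= x) ->
  Phi ((x - K * dl) * isqrt (dl ^+ 2 + 1)) - Phi (- K)
    - approximation_error h x dl (ratio n) <= fine (P E) <=
  Phi ((x + K * dl) * isqrt (dl ^+ 2 + 1)) + (1 - Phi K)
    + approximation_error h x dl (ratio n).
Proof.
move=> th01 law n0 r0 th_h dl0 mE Elt Ele.
have [b1 bq] := ramp_weights r0.
have gs z : `|\int[P]_w Phi ((z - weighted_noise G eps n w) / dl) -
    Phi (z * isqrt (dl ^+ 2 + 1))| <= heat_cst dl * (third_abs_moment G * ratio n + ratio n ^+ 2).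
  under eq_Rintegral do rewrite (weighted_noiseE _ r0).
  exact: (gaussian_smoothing_bound law G3 sg2_gt0 b1 z dl0 bq).
have mV := measurable_weighted_noise G eps n.
have iYV := L1_pivot_error th01 law G3 n0 th_h mu_gt0 sg2_gt0 x r0.
have EYV := expect_pivot_error th01 law G3 n0 th_h mu_gt0 sg2_gt0 x r0.
have dli : 0 <= dl^-1 by rewrite invr_ge0 ltW.
have := ler_wpM2r dli EYV.
have hle := probability_le_smoothed K mV iYV dl0 mE Ele.
have hge := probability_ge_smoothed K mV iYV dl0 mE Elt.
have := gs (x - K * dl); have := gs (x + K * dl); move: hle hge.
rewrite /approximation_error.
move: (heat_cst dl * _) (pivot_error_cst G h x * _ / dl) => c1 c2.
set i1 := Rintegral _ _ _ / dl; set i2 := Rintegral _ _ _; set i3 := Rintegral _ _ _.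
move: i1 i2 i3 => i1 i2 i3 ? ?; rewrite !ler_norml.
by move=> /andP[? ?] /andP[? ?] ?; apply/andP; split; lra.
Qed.

Variables (P : R -> probability Omega R) (h : R).
Hypothesis HP : forall theta, 0 <= theta <= 1 -> inar1_law Z eps G theta (P theta).
Hypothesis h_ge0 : 0 <= h.

(** The scale dl and the cut-off K are fixed before n: the shift K dl, the
    inflation of the variance and the tails beyond K cost e/4 each, and then
    the error, which is proportional to n / ramp n, tends to 0.  The event E is
    only located between two events on the pivot, which lets the same lemma
    serve for tau <= x and for tau < x. *)
Lemma event_probability_cvg (x : R) (E : nat -> set Omega) :
  (forall n, measurable (E n)) ->
  (forall n w, 0 < ramp R n -> pivot G Z eps n x w < x -> E n w) ->
  (forall n w, 0 < ramp R n -> E n w -> pivot G Z eps n x w <= x) ->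
  P (1 - h / n%:R ^+ 2) (E n) @[n --> \oo] --> (Phi x)%:E.
Proof.
move=> mE Elt Ele; apply/fine_cvgP; split; first by near=> n; exact: fin_num_measure.
apply/cvgrPdist_le => e e0.
have e4 : 0 < e / 4 by rewrite divr_gt0.
have [K [K1 K2]] := Phi_tails e4.
have [dl [dl0 [P1 P2]]] := Phi_smoothed_cvg x K e4.
(* C bounds the error per unit of ratio n, as long as ratio n <= 1. *)
pose C := heat_cst dl * (third_abs_moment G + 1) + `|pivot_error_cst G h x| / dl.
have C0 : 0 <= C.
  rewrite addr_ge0 ?divr_ge0 ?(ltW dl0)// mulr_ge0 ?heat_cst_ge0//.
  by rewrite addr_ge0// third_abs_moment_ge0.
have eC : 0 < Num.min 1 (e / 4 / (C + 1)).
  by rewrite lt_min ltr01 divr_gt0// ltr_wpDl.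
near=> n.
have [n2 r0] : [/\ (2 <= n)%N, 0 < ramp R n & ratio n < Num.min 1 (e / 4 / (C + 1))].
  by near: n; exact: ratio_small.
rewrite lt_min => /andP[q1 qC].
have n0 : (0 < n)%N by rewrite (leq_trans _ n2).
have nn0 : 0 < n%:R ^+ 2 :> R by rewrite exprn_gt0// ltr0n.
have hn : h <= n%:R ^+ 2.
  have nr : 1 <= n%:R :> R by rewrite ler1n.
  have hn1 : h < n%:R by near: n; exact: nbhs_infty_gtr.
  by nra.
have th01 : 0 <= 1 - h / n%:R ^+ 2 <= 1.
  by rewrite subr_ge0 ler_pdivrMr// mul1r hn/= gerBl divr_ge0 ?(ltW nn0).
have th_h : (1 - (1 - h / n%:R ^+ 2)) * n%:R ^+ 2 <= h.
  by rewrite opprB addrC subrK divfK// gt_eqF.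
have q0 : 0 <= ratio n by rewrite divr_ge0// ltW.
have := event_probability_bound K th01 (HP th01) n0 r0 th_h dl0 (mE n)
  (fun w => Elt n w r0) (fun w => Ele n w r0).
have err_small : approximation_error h x dl (ratio n) <= e / 4.
  apply: (@le_trans _ _ (C * ratio n)).
    rewrite /approximation_error /C [leRHS]mulrDl; apply: lerD.
      rewrite -[leRHS]mulrA; apply: ler_wpM2l; first exact: heat_cst_ge0.
      by rewrite [leRHS]mulrDl mul1r lerD2l expr2 ler_piMl// ltW.
    rewrite mulrAC; apply: ler_wpM2r => //.
    by apply: ler_wpM2r; rewrite ?ler_norm// invr_ge0 ltW.
  rewrite ltr_pdivlMr in qC; last by rewrite ltr_wpDl.
  by apply/ltW/(le_lt_trans _ qC); rewrite mulrC ler_wpM2l// lerDl.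
move: P1 P2; rewrite !ltr_norml => /andP[? ?] /andP[? ?] /andP[? ?].
by rewrite /= ler_norml; apply/andP; split; lra.
Unshelve. all: end_near. Qed.

End dickey_fuller_limit.

Theorem proposition4p5 (R : realType) (G : probability nat R)
    (d : measure_display) (Omega : measurableType d)
    (Z : nat -> nat -> {mfun Omega >-> bool}) (eps : nat -> {mfun Omega >-> nat})
    (P : R -> probability Omega R)
    (HP : forall theta : R, 0 <= theta <= 1 -> inar1_law Z eps G theta (P theta))
    (HG : innovation_assumption G)
    (HG3 : ('E_G[fun k => (k%:R ^+ 3)%R] < +oo)%E) (h : R) (Hh : 0 <= h) :
  cvg_in_distribution
    (fun n => distribution (P (1 - h / n%:R ^+ 2)) (tau Z eps G n))
    (normal_prob 0 1) /\
  forall alpha : R, 0 < alpha < 1 ->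
    P (1 - h / n%:R ^+ 2) [set w | tau Z eps G n w < Phi_inv alpha]
      @[n --> \oo] --> alpha%:E.
Proof.
have mu0 := mean_of_gt0 HG3 HG; have v0 := variance_of_gt0 HG3 HG.
have mtau n A : measurable A -> measurable (tau Z eps G n @^-1` A).
  by move=> mA; rewrite -[X in measurable X]setTI; exact: measurable_tau.
split=> [x _|alpha a01].
- rewrite [X in _ --> X](_ : _ = (Phi x)%:E); last by rewrite Phi_EFin.
  apply: (event_probability_cvg HG3 HG HP Hh
    (E := fun n => tau Z eps G n @^-1` `]-oo, x]%classic)).
  + by move=> n; exact: mtau.
  + move=> n w r0 /(pivot_lt_tau Z eps mu0 v0 x w r0).1.
    by rewrite /= in_itv/= => /ltW.
  + by move=> n w r0; rewrite /= in_itv/=; exact: (pivot_lt_tau Z eps mu0 v0 x w r0).2.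
- rewrite -[in X in _ --> X](Phi_inv_cancel a01); apply: (event_probability_cvg HG3 HG HP Hh
    (E := fun n => [set w | tau Z eps G n w < Phi_inv alpha])).
  + move=> n; rewrite (_ : [set w | _] = tau Z eps G n @^-1` `]-oo, Phi_inv alpha[%classic).
      exact: mtau.
    by apply/seteqP; split=> w; rewrite /= in_itv.
  + by move=> n w r0 /(pivot_lt_tau Z eps mu0 v0 _ w r0).1.
  + by move=> n w r0 /ltW; exact: (pivot_lt_tau Z eps mu0 v0 _ w r0).2.
Qed.
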